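(* Let $k\ge1$, $\ell\ge0$, $\beta\ge1$ be integers and let $1\le s_1<s_2<\dots<s_k$ and $1\le\alpha_1<\alpha_2<\dots<\alpha_\ell\le\lfloor\beta/2\rfloor$ be integers. Put $d=\gcd(s_1,s_2,\dots,s_k)$ and $\delta=\gcd(\alpha_1,\alpha_2,\dots,\alpha_\ell,\beta)$, and suppose that $d$ and $\delta$ are relatively prime. For positive integers $n$ with $s_k\le\lfloor\beta n/2\rfloor$ let $\tau(n)$ be the number of spanning trees of the circulant graph $C_{\beta n}(s_1,\dots,s_k,\alpha_1n,\dots,\alpha_\ell n)$. Then $$\tau(n)\sim\frac{n\,\delta^2\,d^2}{\beta\,q}\,A^n\qquad\text{as } n\to\infty \text{ with } \gcd(n,d)=1,$$ where $q=s_1^2+s_2^2+\dots+s_k^2$, $A=\prod_{u=0}^{\beta-1}M(P_u)$, and $M(P_u)=\exp\left(\int_0^1\log|P_u(e^{2\pi i t})|\,dt\right)$ is the Mahler measure of the Laurent polynomial $$P_u(z)=2k-\sum_{i=1}^k(z^{s_i}+z^{-s_i})+4\sum_{m=1}^{\ell}\sin^2\!\left(\frac{\pi u\alpha_m}{\beta}\right).$$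
   Context: Here $f(n)\sim g(n)$ means $f(n)/g(n)\to1$. For integers $1\le c_1,\dots,c_r\le N/2$, the circulant graph $C_N(c_1,\dots,c_r)$ is the loopless multigraph on vertices $0,1,\dots,N-1$ in which each vertex $i$ is joined to $i\pm c_1,\dots,i\pm c_r \pmod N$, counted with multiplicity: the number of edges between distinct vertices $x$ and $y$ is the number of pairs $(j,\epsilon)$, $1\le j\le r$, $\epsilon\in\{+1,-1\}$, with $y\equiv x+\epsilon c_j \pmod N$. Thus every vertex has degree $2r$; in particular a jump $c_j=N/2$ produces double edges between opposite vertices, and coinciding jumps produce multiple edges. Equivalently, the Laplacian matrix is $2rI_N-\sum_{j=1}^r(T^{c_j}+T^{-c_j})$ where $T$ is the $N\times N$ cyclic shift permutation matrix. Spanning trees are counted with parallel edges regarded as distinct. $\ell=0$ means there are no jumps $\alpha_m n$ (and then $\delta=\beta$). *)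

(* Defs.v *)
(* Library: MathComp with MathComp-Analysis; complex numbers are R[i] over a
   realType R, from mathcomp-real-closed. *)
From HB Require Import structures.
From mathcomp Require Import all_boot all_order all_algebra.
From mathcomp Require Import complex.
From mathcomp Require Import all_classical all_reals all_analysis.

Set Implicit Arguments.
Unset Strict Implicit.
Unset Printing Implicit Defensive.

Import Order.TTheory GRing.Theory Num.Theory.
Import numFieldNormedType.Exports.

Local Open Scope ring_scope.

Section Multigraphs.
Local Open Scope nat_scope.

(* An edge carries an ordered pair of ends only to name them; `joins` forgets
   the order. *)
Record multigraph := Multigraph {
  vertex : finType;
  edge : finType;
  ends : edge -> vertex * vertex
}.

Definition joins (G : multigraph) (e : edge G) (x y : vertex G) : bool :=
  (ends e == (x, y)) || (ends e == (y, x)).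

(* The spanning subgraph whose edges are those in F is connected. *)
Definition connected_by (G : multigraph) (F : {set edge G}) : bool :=
  [forall x, forall y,
    connect (fun u v => [exists e in F, joins e u v]) x y].

(* The sequence (e_1, x_1), ..., (e_m, x_m) stands for the closed walk
   x_m -e_1- x_1 -e_2- ... -e_m- x_m. Edges and vertices are pairwise distinct,
   so m = 1 is a loop and m = 2 a pair of parallel edges. *)
Definition is_cycle (G : multigraph) (F : {set edge G})
    (p : seq (edge G * vertex G)) : bool :=
  [&& p != [::],
      all (fun a => a.1 \in F) p,
      uniq [seq a.1 | a <- p],
      uniq [seq a.2 | a <- p]
    & cycle (fun a b => joins b.1 a.2 b.2) p].

Definition acyclic (G : multigraph) (F : {set edge G}) : Prop :=
  forall p : seq (edge G * vertex G), ~~ is_cycle F p.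

Definition spanning_tree (G : multigraph) (F : {set edge G}) : Prop :=
  connected_by F /\ acyclic F.

(* Trees are sets of edges, so parallel edges are distinguished. *)
Definition nb_spanning_trees (G : multigraph) : nat :=
  #|[set F : {set edge G} | `[< spanning_tree F >]]|.

(* y = x + c_j mod N for (j, true) and y = x - c_j mod N for (j, false),
   where the jumps c_j = c`_j are indexed from 0. *)
Definition circulant_step (N : nat) (c : seq nat) (x y : 'I_N)
    (je : 'I_(size c) * bool) : bool :=
  if je.2 then y == x + nth 0 c je.1 %[mod N]
  else y + nth 0 c je.1 == x %[mod N].

(* The edges between x and y, with x < y, are the pairs (j, eps) such that
   y = x + eps c_j mod N. *)
Definition circulant_edge (N : nat) (c : seq nat) : finType :=
  {e : ('I_N * 'I_N) * ('I_(size c) * bool)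
     | (e.1.1 < e.1.2) && circulant_step e.1.1 e.1.2 e.2}.

Definition circulant (N : nat) (c : seq nat) : multigraph :=
  @Multigraph 'I_N (circulant_edge N c) (fun e => (val e).1).

Lemma circulant_multiplicity (N : nat) (c : seq nat) (x y : 'I_N) :
  x != y ->
  #|[set e : edge (circulant N c) | joins e x y]|
  = #|[set je | circulant_step (c := c) x y je]|.
Proof.
wlog xy : x y / x < y => [hw|] xNy.
  have [xy|yx|/val_inj xy] := ltngtP x y; first exact: hw.
  - have := hw y x yx; rewrite eq_sym => /(_ xNy) h.
    transitivity #|[set e : edge (circulant N c) | joins e y x]|.
      by apply: eq_card => e; rewrite !inE /joins orbC.
    rewrite h.
    pose f (je : 'I_(size c) * bool) := (je.1, ~~ je.2).
    have fK : involutive f by case=> j b; rewrite /f /= negbK.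
    rewrite -(card_imset _ (can_inj fK)); apply: eq_card => je.
    rewrite !inE; apply/imsetP/idP => [[[j b]]|] /=.
      by rewrite inE /circulant_step => h' -> /=; case: b h' => /=; rewrite eq_sym.
    case: je => j b h'; exists (f (j, b)); rewrite ?fK // inE.
    by case: b h'; rewrite /circulant_step /= eq_sym.
  - by rewrite xy eqxx in xNy.
pose f (e : circulant_edge N c) := (val e).2.
rewrite -(@card_in_imset _ _ f); last first.
  move=> e e'; rewrite !inE /joins /= => /orP[]/eqP h /orP[]/eqP h' ff.
  - by apply: val_inj; apply/eqP; rewrite -pair_eqE /= /pair_eq h h' eqxx; apply/eqP.
  - by have /andP[+ _] := valP e'; rewrite h' /= ltnNge ltnW.
  - by have /andP[+ _] := valP e; rewrite h /= ltnNge ltnW.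
  - by apply: val_inj; apply/eqP; rewrite -pair_eqE /= /pair_eq h h' eqxx; apply/eqP.
apply: eq_card => je; rewrite !inE; apply/imsetP/idP => [[e]|h].
  rewrite inE /joins /= => /orP[]/eqP h ->; have /andP[] := valP e; rewrite h //=.
  by rewrite ltnNge ltnW.
have p : ((x, y, je).1.1 < (x, y, je).1.2)
         && circulant_step (x, y, je).1.1 (x, y, je).1.2 (x, y, je).2.
  by rewrite /= xy.
by exists (exist _ (x, y, je) p); rewrite // inE /joins /= eqxx.
Qed.

End Multigraphs.

Section MahlerMeasure.
Variable R : realType.
Local Open Scope complex_scope.

(* t |-> e^(2 pi i t) *)
Definition unit_circle (t : R) : R[i] :=
  cos (2 * pi * t) +i* sin (2 * pi * t).

(* The library sets ln 0 = 0 where log 0 = -oo is meant: this does not affect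
   the integral when P, as any nonzero Laurent polynomial, has finitely many
   zeros on the unit circle. *)
Definition mahler_measure (P : R[i] -> R[i]) : R :=
  expR (\int[@lebesgue_measure R]_(t in `[0, 1]%classic)
          ln (ComplexField.Normc.normc (P (unit_circle t)))).

(* P_u(z), with k = size s; s lists the s_i and alpha the alpha_m. *)
Definition circulant_poly (beta : nat) (s alpha : seq nat) (u : nat)
    (z : R[i]) : R[i] :=
  2 * (size s)%:R - \sum_(a <- s) (z ^+ a + z ^- a)
  + (4 * \sum_(a <- alpha) sin (pi * u%:R * a%:R / beta%:R) ^+ 2)%:C.

End MahlerMeasure.

(* Main.v *)
Require Import Defs.
From HB Require Import structures.
From mathcomp Require Import all_boot all_order all_algebra.
From mathcomp Require Import complex.
From mathcomp Require Import all_classical all_reals all_analysis.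
From mathcomp Require Import fingroup perm measurable_realfun ring lra.

Set Implicit Arguments.
Unset Strict Implicit.
Unset Printing Implicit Defensive.

Import Order.TTheory GRing.Theory Num.Theory.
Import numFieldNormedType.Exports.

Local Open Scope ring_scope.

(** Put N = beta n and e(x) = exp (2 pi i x). By the matrix-tree theorem and
    the discrete Fourier transform, N tau(n) is the product over 0 < j < N of
    the eigenvalues of the Laplacian, and the j-th one is P_u(e(j/N)) with
    u = j mod beta. For fixed u, the points e(j/N) are the n-th roots of
    eta = e(u/beta), so that N tau(n) is a product over u of the numbers
    prod_(z^n = eta) |P_u(z)|, where z = 1 is left out for u = 0
    (circulant_trees_symbol).

    A factor z - w of P_u contributes |w^n - eta| to this product, which is
    asymptotic to max(1, |w|)^n as soon as |w| <> 1 (root_product_growth).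
    By Jensen's formula the Mahler measure of P_u is the product of the
    max(1, |w|) and of the leading coefficient (mahler_measure_roots). Hence a
    P_u without zeros on the unit circle contributes M(P_u)^n.

    On the unit circle P_u(z) = sum_i |1 - z^(s_i)|^2 + W_u, where
    W_u = sum_m |1 - e(u alpha_m / beta)|^2 (circulant_poly_unit). So P_u has
    zeros there only if W_u = 0, that is, if beta/delta divides u
    (coupling_eq0). In this case P_u = P_0, whose zeros on the circle are the
    d-th roots of unity, all double: |P_0(z)| = |1 - z^d|^2 |g(z)| with g free
    of zeros on the circle and |g(1)| = q/d^2 (symbol_factor_decoupled).
    The polynomial z^d - 1 has Mahler measure 1, and since gcd(n, d) = 1 the
    product of the |1 - z^d| over z^n = eta is |1 - eta^d|. As u varies, eta
    runs over the delta-th roots of unity; those other than 1 give delta in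
    total, because gcd(d, delta) = 1 (prod_coupling_zero), and eta = 1, with
    z = 1 left out, gives n (prod_twist0). The excluded value |g(1)| must also
    be divided out. Altogether tau(n) equals
    (n delta^2 d^2 / (beta q)) prod_u prod_(z^n = eta) |g_u(z)| exactly, where
    g_u is P_u deprived of its zeros on the circle
    (nb_spanning_trees_factored), and the theorem follows.

    The matrix-tree theorem is obtained by choosing one term in each row of
    the Laplacian, the row of a root excepted: a choice is a map sending each
    vertex to an edge towards a parent, its determinant is 1 if all vertices
    lead to the root and 0 otherwise, and the choices of the first kind
    correspond to the spanning trees. Jensen's formula for z - w follows, for
    |w| < 1, from the duplication |z^2 - w^2| = |z - w| |-z - w|; for |w| > 1,
    from the reflection w -> 1 / conj w; for |w| = 1, by letting r w tend to w
    with r < 1. *)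

(** * The unit circle *)

Section UnitCircle.
Variable R : realType.
Local Open Scope complex_scope.
Import ComplexField.Normc.
Implicit Types (t : R) (z w : R[i]).

Lemma normc_ge0 z : 0 <= normc z.
Proof. by case: z => a b; rewrite /normc sqrtr_ge0. Qed.

Lemma normc_eq0 z : (normc z == 0) = (z == 0).
Proof. by apply/eqP/eqP => [/eq0_normc//|->]; rewrite normc0. Qed.

Lemma normc_gt0 z : (0 < normc z) = (z != 0).
Proof. by rewrite lt_def normc_ge0 andbT normc_eq0. Qed.

Lemma normcX z n : normc (z ^+ n) = normc z ^+ n.
Proof. by elim: n => [|n ih]; rewrite ?expr0 ?normc1// !exprS normcM ih. Qed.

Lemma normc_prod (I : Type) (r : seq I) (P : pred I) (F : I -> R[i]) :
  normc (\prod_(i <- r | P i) F i) = \prod_(i <- r | P i) normc (F i).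
Proof.
by apply: (big_morph (@normc R)); [exact: normcM | exact: normc1].
Qed.

Lemma normcB z w : normc (z - w) = normc (w - z).
Proof. by rewrite -normcN opprB. Qed.

Lemma normcJ z : normc (conjc z) = normc z.
Proof. by case: z => a b /=; rewrite sqrrN. Qed.

Lemma normc_real (x : R) : normc x%:C = `|x|.
Proof. by rewrite /normc /= expr0n /= addr0 sqrtr_sqr. Qed.

Lemma normc_nat n : normc (n%:R : R[i]) = n%:R.
Proof. by rewrite -(rmorph_nat (@real_complex R)) normc_real ger0_norm. Qed.

Lemma le_normcB z w : normc z - normc w <= normc (z - w).
Proof. by have := le_normcD (z - w) w; rewrite subrK lerBlDr. Qed.

Lemma unit_circleD a b : unit_circle (a + b) = unit_circle a * unit_circle b :> R[i].
Proof.
rewrite /unit_circle mulrDr cosD sinD; apply/eqP; rewrite eq_complex /=.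
by apply/andP; split; apply/eqP; ring.
Qed.

Lemma unit_circle0 : unit_circle 0 = 1 :> R[i].
Proof. by rewrite /unit_circle mulr0 cos0 sin0. Qed.

Lemma unit_circle1 : unit_circle 1 = 1 :> R[i].
Proof. by rewrite /unit_circle mulr1 mulrC mulr_natr cos2pi sin2pi. Qed.

Lemma unit_circle_half : unit_circle 2^-1 = -1 :> R[i].
Proof.
rewrite /unit_circle mulrAC divff ?pnatr_eq0// mul1r cospi sinpi.
by apply/eqP; rewrite eq_complex /= oppr0 !eqxx.
Qed.

Lemma unit_circleX t n : unit_circle (n%:R * t) = unit_circle t ^+ n :> R[i].
Proof.
elim: n => [|n ih]; first by rewrite mul0r unit_circle0.
by rewrite exprS -ih -unit_circleD -natr1 mulrDl mul1r addrC.
Qed.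

Lemma unit_circle_nat n : unit_circle n%:R = 1 :> R[i].
Proof. by rewrite -[n%:R]mulr1 unit_circleX unit_circle1 expr1n. Qed.

Lemma normc_unit_circle t : normc (unit_circle t) = 1 :> R.
Proof. by rewrite /normc /= cos2Dsin2 sqrtr1. Qed.

Lemma unit_circle_neq0 t : unit_circle t != 0 :> R[i].
Proof. by rewrite -normc_gt0 normc_unit_circle. Qed.

Lemma unit_circleN t : unit_circle (- t) = (unit_circle t)^-1 :> R[i].
Proof.
apply: (mulfI (unit_circle_neq0 t)).
by rewrite -unit_circleD subrr unit_circle0 divff// unit_circle_neq0.
Qed.

Lemma conj_unit_circle t : conjc (unit_circle t) = (unit_circle t)^-1 :> R[i].
Proof.
by rewrite -unit_circleN /unit_circle mulrN cosN sinN.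
Qed.

(** Because 1 - cos (2 pi t) = 2 sin^2 (pi t) and sin is positive on ]0, pi[. *)
Lemma unit_circle_eq1 t : -1 < t < 1 -> unit_circle t = 1 :> R[i] -> t = 0.
Proof.
move=> /andP[t1 t2] [] h _.
have h' : sin (pi * t) ^+ 2 = 0.
  have : 1 - cos (2 * pi * t) = 2 * sin (pi * t) ^+ 2.
    by rewrite -mulrA mulr_natl cos_mulr2n sin2cos2; ring.
  rewrite h subrr => /esym/eqP; rewrite mulf_eq0 pnatr_eq0/= => /eqP.
  by [].
have {}h' : sin (pi * t) = 0 by apply/eqP; rewrite -sqrf_eq0 h'.
have p0 := pi_gt0 R.
apply/eqP; apply: contraT; rewrite neq_lt => /orP[t0|t0].
  have : 0 < sin (pi * (- t)) by apply: sin_gt0_pi; nra.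
  by rewrite mulrN sinN h' oppr0 ltxx.
have : 0 < sin (pi * t) by apply: sin_gt0_pi; nra.
by rewrite h' ltxx.
Qed.

Lemma unit_circle_inj a b : `|a - b| < 1 ->
  unit_circle a = unit_circle b :> R[i] -> a = b.
Proof.
rewrite ltr_norml => ab h; apply/eqP; rewrite -subr_eq0; apply/eqP.
apply: unit_circle_eq1 => //.
by rewrite unit_circleD h -unit_circleD subrr unit_circle0.
Qed.

Lemma continuous_normc_unit_circleB w :
  continuous (fun t => normc (unit_circle t - w) : R).
Proof.
move=> t; case: w => a b; rewrite /unit_circle /normc /=.
apply: continuous_comp; last exact: sqrt_continuous.
apply: continuousD; apply: (@continuous_comp _ _ _ _ (fun x : R => x ^+ 2)).
- apply: continuousB; last exact: cst_continuous.
  apply: continuous_comp; last exact: continuous_cos.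
  by apply: continuousM; [exact: cst_continuous|].
- exact: exprn_continuous.
- apply: continuousB; last exact: cst_continuous.
  apply: continuous_comp; last exact: continuous_sin.
  by apply: continuousM; [exact: cst_continuous|].
- exact: exprn_continuous.
Qed.

End UnitCircle.

(** * Jensen's formula *)

Section Jensen.
Variable R : realType.
Local Open Scope classical_set_scope.
Local Open Scope ring_scope.
Local Open Scope complex_scope.
Import ComplexField.Normc.
Implicit Types (t : R) (z w : R[i]).
Local Notation mu := (@lebesgue_measure R).
Local Notation logdist w := (fun t : R => ln (normc (unit_circle t - w)) : R).

Lemma continuous_logdist w : normc w != 1 -> continuous (logdist w).
Proof.
move=> w1 t; apply: (@continuous_comp _ _ _ (fun t => normc (unit_circle t - w))).
  exact: continuous_normc_unit_circleB.
apply: continuous_ln; rewrite normc_gt0 subr_eq0.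
by apply: contra w1 => /eqP <-; rewrite normc_unit_circle.
Qed.

Lemma measurable_logdist w (D : set R) : measurable_fun D (logdist w).
Proof.
apply: measurable_funTS; apply: measurableT_comp; first exact: measurable_ln.
by apply: continuous_measurable_fun; exact: continuous_normc_unit_circleB.
Qed.

Lemma continuous_integrable01 (G : R -> R) (a b : R) :
  continuous G -> mu.-integrable `[a, b] (EFin \o G).
Proof.
move=> cG; apply: continuous_compact_integrable; first exact: segment_compact.
by apply: continuous_subspaceT.
Qed.

Lemma Rintegral_cst01 (c : R) : \int[mu]_(x in `[0, 1]) c = c.
Proof.
rewrite Rintegral_cst//=.
by rewrite lebesgue_measure_itv /= lte_fin ltr01 oppr0 adde0 /= mulr1.
Qed.

Lemma integrable_cst01 (c : R) : mu.-integrable `[0, 1] (EFin \o cst c).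
Proof. by apply: (@continuous_integrable01 (cst _)) => t; exact: cst_continuous. Qed.

(** Change of variables x = c + t / 2: with c = 0 and c = 1/2, it carries both
    halves of [0, 1] to [0, 1]. *)
Lemma Rintegral_half (G : R -> R) (c : R) : continuous G ->
  \int[mu]_(x in `[c, c + 2^-1]) G x =
  2^-1 * \int[mu]_(x in `[0, 1]) G (c + 2^-1 * x).
Proof.
move=> cG; pose F x : R := c + 2^-1 * x.
have F' (x : R) : is_derive x 1 F 2^-1.
  rewrite (_ : F = cst c + 2^-1 *: id); last by apply/funext => y.
  by apply: is_derive_eq; rewrite add0r /GRing.scale /= mulr1.
have dF : derive1 F = cst 2^-1.
  by apply/funext => x; rewrite derive1E (@derive_val _ _ _ _ _ _ _ (F' x)).
have cF : continuous F.
  move=> x; apply: differentiable_continuous; apply/derivable1_diffP.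
  by apply: ex_derive.
have cGF : continuous (G \o F).
  by move=> x; apply: continuous_comp; [exact: cF | exact: cG].
rewrite -RintegralZl//; last exact: (continuous_integrable01 _ _ cGF).
rewrite /Rintegral; congr fine.
have -> : c = F 0 by rewrite /F mulr0 addr0.
have -> : F 0 + 2^-1 = F 1 by rewrite /F mulr0 addr0 mulr1.
rewrite integration_by_substitution_increasing //.
- apply: eq_integral => x _; rewrite dF /= mulrC /F.
  by rewrite mulr0 addr0.
- by move=> x y _ _ xy; rewrite /F ltrD2l ltr_pM2l ?invr_gt0.
- by move=> x _; rewrite dF; exact: cst_continuous.
- by rewrite dF; exact: is_cvg_cst.
- by rewrite dF; exact: is_cvg_cst.
- split.
  + by move=> x _; apply: ex_derive.
  + by apply: cvg_at_right_filter; exact: cF.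
  + by apply: cvg_at_left_filter; exact: cF.
- by apply: continuous_subspaceT.
Qed.

(** The points e(t/2) and e(1/2 + t/2) = - e(t/2) are the square roots of e(t),
    and |z - w| |-z - w| = |z^2 - w^2|. *)
Lemma logdist_double w : normc w < 1 ->
  2 * \int[mu]_(t in `[0, 1]) logdist w t = \int[mu]_(t in `[0, 1]) logdist (w ^+ 2) t.
Proof.
move=> w1; have cw := continuous_logdist (negbT (lt_eqF w1)).
have i01 : mu.-integrable `[0, 1] (EFin \o logdist w) := continuous_integrable01 _ _ cw.
have h : \int[mu]_(t in `[0, 1]) logdist w t - \int[mu]_(t in `[0, 2^-1]) logdist w t
       = \int[mu]_(t in `]2^-1, 1]) logdist w t.
  by apply: Rintegral_itvB => //; rewrite bnd_simp ?invr_ge0// invf_le1 ?ler1n.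
have {h}-> : \int[mu]_(t in `[0, 1]) logdist w t =
  \int[mu]_(t in `[0, 0 + 2^-1]) logdist w t
  + \int[mu]_(t in `[2^-1, 2^-1 + 2^-1]) logdist w t.
  have hh : 2^-1 + 2^-1 = 1 :> R by lra.
  rewrite add0r hh -[X in _ + X]Rintegral_itv_obnd_cbnd -?h; first by rewrite addrC subrK.
  by apply: integrableS i01 => //; apply: subset_itvr; rewrite bnd_simp invr_ge0.
rewrite !Rintegral_half // -mulrDr mulrA divff ?pnatr_eq0// mul1r -RintegralD //.
- apply: eq_Rintegral => t _.
  have z t' : unit_circle (2^-1 * t') ^+ 2 = unit_circle t' :> R[i].
    by rewrite -unit_circleX mulrA divff ?pnatr_eq0// mul1r.
  rewrite add0r unit_circleD unit_circle_half mulN1r -lnM ?posrE ?normc_gt0.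
  + by rewrite -normcM -(z t) -normcN; congr (ln (normc _)); ring.
  + rewrite subr_eq0; apply: contraTneq w1 => <-.
    by rewrite normc_unit_circle ltxx.
  + rewrite subr_eq0; apply: contraTneq w1 => <-.
    by rewrite normcN normc_unit_circle ltxx.
- apply: (@continuous_integrable01 (logdist w \o (fun x => 0 + 2^-1 * x))) => t.
  apply: continuous_comp; last exact: cw.
  by apply: continuousD; [exact: cst_continuous|apply: continuousM => //; exact: cst_continuous].
- apply: (@continuous_integrable01 (logdist w \o (fun x => 2^-1 + 2^-1 * x))) => t.
  apply: continuous_comp; last exact: cw.
  by apply: continuousD; [exact: cst_continuous|apply: continuousM => //; exact: cst_continuous].
Qed.

(** For |w| <= r, the distance from w to a point of the circle lies between
    1 - r and 2. The bound does not depend on w, so it holds for all powers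
    of w at once. *)
Lemma logdist_bound w r : normc w <= r -> r < 1 ->
  `|\int[mu]_(t in `[0, 1]) logdist w t| <= ln 2 - ln (1 - r).
Proof.
move=> wr r1; have w1 := le_lt_trans wr r1.
have cw := continuous_logdist (negbT (lt_eqF w1)).
apply: (le_trans (le_normr_Rintegral _ _)) => //; first exact: continuous_integrable01.
have -> : ln 2 - ln (1 - r) = \int[mu]_(t in `[0, 1]) (ln 2 - ln (1 - r)) :> R.
  by rewrite Rintegral_cst01.
apply: le_Rintegral => //.
- apply: continuous_integrable01 => t; apply: (@continuous_comp _ _ _ (logdist w)) => //.
  exact: cw.
  exact: norm_continuous.
- exact: integrable_cst01.
move=> t _.
have r0 : 0 <= r := le_trans (normc_ge0 _) wr.
have l1 : 1 - r <= normc (unit_circle t - w).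
  apply: le_trans (le_normcB _ _); rewrite normc_unit_circle; lra.
have l2 : normc (unit_circle t - w) <= 2.
  by apply: (le_trans (le_normcD _ _)); rewrite normcN normc_unit_circle; lra.
have p1 : 0 < 1 - r by lra.
have p2 := lt_le_trans p1 l1.
have q1 : ln (1 - r) <= ln (normc (unit_circle t - w)) by rewrite ler_ln ?posrE.
have q2 : ln (normc (unit_circle t - w)) <= ln 2 by rewrite ler_ln ?posrE.
have a0 : 0 <= ln 2 :> R by apply: ln_ge0; lra.
have b0 : ln (1 - r) <= 0 by apply: ln_le0; lra.
by rewrite ler_norml; apply/andP; split; lra.
Qed.

(** The integrals J(w) satisfy J(w^(2^m)) = 2^m J(w), and they are bounded. *)
Lemma jensen_inside w : normc w < 1 -> \int[mu]_(t in `[0, 1]) logdist w t = 0.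
Proof.
move=> w1.
have small m : normc (w ^+ (2 ^ m)) <= normc w.
  rewrite normcX -[leRHS]expr1; apply: ler_wiXn2l; rewrite ?normc_ge0 ?ltW//.
  by rewrite expn_gt0.
have it m : \int[mu]_(t in `[0, 1]) logdist (w ^+ (2 ^ m)) t
            = 2 ^+ m * \int[mu]_(t in `[0, 1]) logdist w t.
  elim: m => [|m ih]; first by rewrite expn0 expr1 expr0 mul1r.
  by rewrite expnSr exprM -logdist_double ?ih ?mulrA ?exprS// (le_lt_trans (small m)).
apply/eqP; apply: contraT => J0.
have J0' : 0 < `|\int[mu]_(t in `[0, 1]) logdist w t| by rewrite normr_gt0.
set C := ln 2 - ln (1 - normc w).
have bd m : 2 ^+ m * `|\int[mu]_(t in `[0, 1]) logdist w t| <= C.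
  rewrite -[X in X * _]ger0_norm ?exprn_ge0// -normrM -it.
  by apply: logdist_bound => //; exact: small.
have C0 : 0 <= C / `|\int[mu]_(t in `[0, 1]) logdist w t|.
  by rewrite divr_ge0 // (le_trans _ (bd 0%N)) // expr0 mul1r.
have := Num.Theory.archi_boundP C0; set m := Num.bound _ => hm.
have : m%:R < 2 ^+ m :> R by rewrite -natrX ltr_nat ltn_expl.
move=> /(lt_trans hm); rewrite ltr_pdivrMr // => /lt_le_trans/(_ (bd m)).
by rewrite ltxx.
Qed.

(** Reflection in the circle: |z - w| = |w| |z - w'| for |z| = 1, where
    w' = 1 / conj w lies inside. *)
Lemma jensen_outside w : 1 < normc w ->
  \int[mu]_(t in `[0, 1]) logdist w t = ln (normc w).
Proof.
move=> w1.
have w0 : w != 0 by rewrite -normc_gt0 (lt_trans _ w1).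
pose w' := conjc w^-1.
have w'1 : normc w' < 1 by rewrite normcJ normcV invf_lt1 // (lt_trans _ w1).
transitivity (\int[mu]_(t in `[0, 1]) (ln (normc w) + logdist w' t)).
  apply: eq_Rintegral => t _.
  rewrite -lnM ?posrE ?normc_gt0//; last first.
    rewrite subr_eq0; apply: contraTneq w'1 => <-.
    by rewrite normc_unit_circle ltxx.
  rewrite -(normcJ (_ - w')) -normcM; congr ln.
  have -> : conjc (unit_circle t - w') = (unit_circle t)^-1 - w^-1.
    by rewrite rmorphB; congr (_ - _); [exact: conj_unit_circle | exact: conjcK].
  rewrite mulrBr divff//.
  rewrite -[LHS]mul1r -[X in X * _](normc_unit_circle (- t)) -normcM unit_circleN.
  by rewrite mulrBr mulVf ?unit_circle_neq0// normcB [w * _]mulrC.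
rewrite RintegralD//.
- by rewrite jensen_inside // addr0 Rintegral_cst01.
- exact: integrable_cst01.
- by apply: (@continuous_integrable01 (logdist w')); apply: continuous_logdist; rewrite lt_eqF.
Qed.

End Jensen.

Section JensenUnit.
Variable R : realType.
Local Open Scope classical_set_scope.
Local Open Scope ring_scope.
Local Open Scope complex_scope.
Import ComplexField.Normc.
Implicit Types (t : R) (z w : R[i]).
Local Notation mu := (@lebesgue_measure R).
Local Notation logdist w := (fun t : R => ln (normc (unit_circle t - w)) : R).

(** The exceptional parameter t0 is arbitrary if w is not on the circle. *)
Lemma unit_circle_fiber w : exists t0 : R, forall t, t \in `[0, 1[ ->
  unit_circle t = w -> t = t0.
Proof.
have [[t0 [I0 <-]]|h] := pselect (exists t0 : R, (t0 \in `[0, 1[) /\ (unit_circle t0 = w)).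
  exists t0 => t; move: I0; rewrite !in_itv /= => /andP[a b] /andP[c d].
  by apply: unit_circle_inj; rewrite ltr_norml; apply/andP; split; lra.
by exists 0 => t It e; exfalso; apply: h; exists t.
Qed.

(** The triangle inequality, with |r w - w| = 1 - r <= |z - r w|. It makes
    ln |z - w| - ln 2 a lower bound of ln |z - r w|, uniform in r. *)
Lemma normc_radial_ge t w r : normc w = 1 -> 0 <= r <= 1 ->
  normc (unit_circle t - w) / 2 <= normc (unit_circle t - r%:C * w).
Proof.
move=> w1 /andP[r0 r1].
have h1 : 1 - r <= normc (unit_circle t - r%:C * w).
  apply: le_trans (le_normcB _ _).
  by rewrite normc_unit_circle normcM w1 mulr1 normc_real ger0_norm.
have h2 : normc (unit_circle t - w) <= normc (unit_circle t - r%:C * w) + (1 - r).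
  have -> : unit_circle t - w = (unit_circle t - r%:C * w) + (r%:C - 1) * w by ring.
  apply: (le_trans (le_normcD _ _)); rewrite lerD2l normcM w1 mulr1.
  by rewrite -(rmorph1 (@real_complex R)) -rmorphB normc_real ler0_norm; lra.
by lra.
Qed.

Lemma logdist_radial_cvg t w (r : nat -> R) : r @ \oo --> (1 : R) ->
  unit_circle t != w ->
  (fun n => ln (normc (unit_circle t - (r n)%:C * w))) @ \oo
    --> ln (normc (unit_circle t - w)).
Proof.
move=> r1 tw.
pose f (x : R) := ln (normc (unit_circle t - x%:C * w)).
have f1 : f 1 = ln (normc (unit_circle t - w)).
  by rewrite /f rmorph1 mul1r.
rewrite -f1; apply: (@cvg_comp _ _ _ r f _ (nbhs (1 : R))) => //.
apply: (@continuous_comp _ _ _ (fun x : R => normc (unit_circle t - x%:C * w)) (@ln R)).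
  case: w {f f1 tw} => a b; rewrite /unit_circle /normc /=.
  apply: continuous_comp; last exact: sqrt_continuous.
  apply: continuousD; apply: (@continuous_comp _ _ _ _ (fun x : R => x ^+ 2));
    try exact: exprn_continuous.
  - apply: continuousB; first exact: cst_continuous.
    apply: continuousB; apply: continuousM => //; exact: cst_continuous.
  - apply: continuousB; first exact: cst_continuous.
    apply: continuousD; apply: continuousM => //; exact: cst_continuous.
by apply: continuous_ln; rewrite normc_gt0 rmorph1 mul1r subr_eq0.
Qed.

(** Radial limit of jensen_inside along r n w, where r n tends to 1 from below.
    Fatou's lemma applied to ln 2 - ln |z - r n w| >= 0, whose integral is ln 2,
    shows that ln |z - w| is integrable. Together with normc_radial_ge this
    gives an integrable bound for dominated convergence. *)
Lemma jensen_on_circle w : normc w = 1 ->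
  mu.-integrable `[0, 1] (EFin \o logdist w) /\
  \int[mu]_(t in `[0, 1]) logdist w t = 0.
Proof.
move=> w1; have [t0 ht0] := unit_circle_fiber w.
pose D : set R := `[0, 1[ `\ t0.
have mD : measurable D by exact: measurableD.
have Dne t : D t -> unit_circle t != w.
  by move=> [It tt0]; apply/eqP => e; apply: tt0; exact: ht0.
(* D is [0, 1] without the point where the logarithm is singular and without
   the end 1, which repeats the point 0 of the circle. *)
have DE (f : R -> \bar R) : measurable_fun [set: R] f ->
    (\int[mu]_(x in D) f x = \int[mu]_(x in `[0%R, 1%R]) f x)%E.
  move=> mf; rewrite integral_setD1 //; last exact: measurable_funTS.
  by rewrite integral_itv_bndo_bndc//; exact: measurable_funTS.
pose r (n : nat) : R := 1 - n.+2%:R^-1.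
have r01 n : 0 <= r n < 1.
  by rewrite /r subr_ge0 gtrBl invr_gt0 invf_le1 ?ler1n ?ltr0n.
have r1 : r @ \oo --> (1 : R).
  rewrite -[X in _ --> X]subr0; apply: cvgB; first exact: cvg_cst.
  by have := @cvg_harmonic R; rewrite -cvg_shiftS.
pose f n t : R := logdist ((r n)%:C * w) t.
pose g t : R := logdist w t.
have nrw n : normc ((r n)%:C * w) = r n.
  by rewrite normcM w1 mulr1 normc_real ger0_norm//; case/andP: (r01 n).
have mf n (E : set R) : measurable_fun E (f n) by exact: measurable_logdist.
have mg (E : set R) : measurable_fun E g by exact: measurable_logdist.
have fg t : D t -> (fun n => f n t) @ \oo --> g t.
  by move=> /Dne; exact: logdist_radial_cvg.
have fI n : \int[mu]_(t in `[0, 1]) f n t = 0.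
  by apply: jensen_inside; rewrite nrw; case/andP: (r01 n).
have fi n : mu.-integrable `[0, 1] (EFin \o f n).
  apply: (@continuous_integrable01 R (f n)); apply: continuous_logdist.
  by rewrite nrw lt_eqF//; case/andP: (r01 n).
have fle n t : f n t <= ln 2.
  have tn : unit_circle t - (r n)%:C * w != 0.
    rewrite subr_eq0; apply/eqP => /(congr1 (@normc R)).
    rewrite normc_unit_circle nrw => h; have /andP[_] := r01 n.
    by rewrite -h ltxx.
  rewrite /f ler_ln ?posrE ?normc_gt0//.
  apply: (le_trans (le_normcD _ _)); rewrite normcN normc_unit_circle nrw.
  by have /andP[? ?] := r01 n; lra.
have gef n t : D t -> g t - ln 2 <= f n t.
  move=> /Dne tw; rewrite /g /f -ln_div ?posrE ?normc_gt0 ?subr_eq0//.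
  have p : 0 < normc (unit_circle t - w) / 2.
    by rewrite divr_gt0// normc_gt0 subr_eq0.
  have le : normc (unit_circle t - w) / 2 <= normc (unit_circle t - (r n)%:C * w).
    by apply: normc_radial_ge => //; have /andP[? ?] := r01 n; lra.
  by rewrite ler_ln ?posrE //; exact: lt_le_trans le.
have gle t : D t -> g t <= ln 2.
  move=> /fg h; rewrite -(cvg_lim _ h)//; apply: limr_le; first by apply/cvg_ex; exists (g t).
  by apply: nearW => n.
have ln20 : 0 <= ln 2 :> R by apply: ln_ge0; lra.
pose h n t : \bar R := (ln 2 - f n t)%:E.
pose k t : \bar R := (ln 2 - g t)%:E.
have mk E : measurable_fun E k.
  by apply/measurable_EFinP; apply: measurable_funB => //.
have mh n E : measurable_fun E (h n).
  by apply/measurable_EFinP; apply: measurable_funB => //.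
have hI n : (\int[mu]_(t in D) h n t = (ln 2)%:E)%E.
  rewrite DE //.
  have -> : (\int[mu]_(t in `[0%R, 1%R]) h n t)%E
      = (\int[mu]_(t in `[0, 1]) (ln 2 - f n t))%:E.
    rewrite /Rintegral fineK //; apply: integrable_fin_num => //.
    have := @integrableB _ _ _ mu `[0, 1] _ _ _
       (integrable_cst01 (ln 2)) (fi n).
    by apply.
  rewrite RintegralB //; first by rewrite fI subr0 Rintegral_cst01.
  exact: integrable_cst01.
have kI : (\int[mu]_(t in D) k t <= (ln 2)%:E)%E.
  have h0 n x : D x -> (0 <= h n x)%E.
    by move=> Dx; rewrite lee_fin subr_ge0.
  have := fatou mu mD (fun n => mh n D) h0.
  have -> : (\int[mu]_(x in D) limn_einf (h^~ x) = \int[mu]_(x in D) k x)%E.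
    apply: eq_integral => x /set_mem Dx.
    suff hk : h ^~ x @ \oo --> k x by rewrite (cvg_limn_einf_sup hk).1.
    apply: cvg_EFin; first by apply: nearW.
    by apply: cvgB; [exact: cvg_cst | exact: fg].
  move=> /le_trans; apply.
  under eq_fun do rewrite hI.
  have hk : (cst (ln 2 : R)%:E : nat -> \bar R) @ \oo --> (ln 2)%:E by exact: cvg_cst.
  by rewrite (cvg_limn_einf_sup hk).1.
have ki : mu.-integrable D k.
  apply/integrableP; split; first exact: mk.
  apply: le_lt_trans (ltry (ln 2)); apply: le_trans kI.
  rewrite (_ : integral _ _ _ = \int[mu]_(x in D) k x)%E //.
  apply: eq_integral => x /set_mem Dx.
  by rewrite gee0_abs// lee_fin subr_ge0 gle.
have ci : mu.-integrable D (cst (ln 2 : R)%:E).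
  apply: (@integrableS _ _ _ mu `[0, 1]) => //.
    by move=> x [/= + _]; rewrite !in_itv /= => /andP[-> /ltW].
  exact: integrable_cst01.
have [|||||gi _ gI] := @dominated_convergence _ _ _ mu D mD (fun n => EFin \o f n)
   (EFin \o g) (k \+ cst (ln 2)%:E)%E.
- by move=> n; apply/measurable_EFinP; exact: mf.
- by apply/measurable_EFinP; exact: mg.
- apply: aeW => x Dx; apply: cvg_EFin; first by apply: nearW.
  exact: fg.
- exact: integrableD.
- apply: aeW => x n Dx; rewrite /= lee_fin.
  have := gef n x Dx; have := fle n x; have := gle x Dx => ? ? ?.
  by rewrite ler_norml; apply/andP; split; lra.
have I0 : (\int[mu]_(x in D) (EFin \o g) x = 0)%E.
  apply: (@cvg_unique _ _ _ _ _ _ gI); first by exact: ereal_hausdorff.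
  have -> : [sequence (\int[mu]_(x in D) (EFin \o f n) x)%E]_n = cst 0%E.
    apply/funext => n /=; rewrite DE; last by apply/measurable_EFinP; exact: mf.
    have := fI n; rewrite /Rintegral => e; rewrite -[LHS]fineK ?e //.
    by apply: integrable_fin_num => //; exact: fi.
  exact: cvg_cst.
split; last by rewrite /Rintegral -(DE (EFin \o g)) ?I0//; apply/measurable_EFinP; exact: mg.
case/integrableP: gi => _ gi; apply/integrableP; split.
  by apply/measurable_EFinP; exact: mg.
rewrite -(DE (fun x => `|(EFin \o g) x|%E))//.
by apply: measurableT_comp => //; apply/measurable_EFinP; exact: mg.
Qed.

Lemma jensen_linear w :
  mu.-integrable `[0, 1] (EFin \o logdist w) /\
  \int[mu]_(t in `[0, 1]) logdist w t = ln (Num.max 1 (normc w)).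
Proof.
have [w1|w1|w1] := ltgtP (normc w) 1.
- split; last by rewrite jensen_inside// ln1.
  by apply: (@continuous_integrable01 R (logdist w)); apply: continuous_logdist; rewrite lt_eqF.
- split; last by rewrite jensen_outside.
  by apply: (@continuous_integrable01 R (logdist w)); apply: continuous_logdist; rewrite gt_eqF.
- by have [i ->] := jensen_on_circle w1; rewrite ?w1 ?maxxx ln1.
Qed.

Lemma unit_circle_fiber_negligible w :
  mu.-negligible [set t : R | `[0, 1]%classic t /\ unit_circle t = w].
Proof.
have [t0 ht0] := unit_circle_fiber w.
exists ([set t0] `|` [set 1]); split.
- exact: measurableU.
- by rewrite null_set_setU //; exact: lebesgue_measure_set1.
move=> t [/=]; rewrite in_itv /= => /andP[t00]; rewrite le_eqVlt => /orP[/eqP->|t1 e].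
  by right.
by left; apply: ht0 => //; rewrite in_itv /= t00.
Qed.

(** Jensen's formula, for a function whose modulus on the unit circle is that
    of a polynomial; rs may contain points of the circle. The logarithm of the
    product is the sum of the logarithms except at these finitely many
    zeros. *)
Lemma mahler_measure_roots (P : R[i] -> R[i]) (C : R) (rs : seq R[i]) : 0 < C ->
  (forall t, normc (P (unit_circle t)) = C * \prod_(w <- rs) normc (unit_circle t - w)) ->
  mahler_measure P = C * \prod_(w <- rs) Num.max 1 (normc w).
Proof.
move=> C0 PE; rewrite /mahler_measure.
pose S t := ln C + \sum_(w <- rs) logdist w t.
have [Si SI] : mu.-integrable `[0, 1] (EFin \o S) /\
    \int[mu]_(t in `[0, 1]) S t = ln C + \sum_(w <- rs) ln (Num.max 1 (normc w)).
  have ci : mu.-integrable `[0, 1] (EFin \o cst (ln C)).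
    exact: integrable_cst01.
  have [si sI] : mu.-integrable `[0, 1] (EFin \o (fun t => \sum_(w <- rs) logdist w t)) /\
    \int[mu]_(t in `[0, 1]) (\sum_(w <- rs) logdist w t)
      = \sum_(w <- rs) ln (Num.max 1 (normc w)).
    elim: rs {PE S} => [|w rs [ih1 ih2]].
      split; last first.
        rewrite big_nil; under eq_Rintegral do rewrite big_nil.
        exact: Rintegral_cst01.
      apply: (@eq_integrable _ _ _ mu _ _ (cst 0%:E)) => //.
        by move=> x _; rewrite /= big_nil.
      exact: integrable_cst01.
    have [i1 i2] := jensen_linear w.
    pose s t : R := \sum_(w <- rs) logdist w t.
    split.
      apply: (@eq_integrable _ _ _ mu _ _ ((EFin \o logdist w) \+ (EFin \o s))%E) => //;
        last exact: integrableD.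
      by move=> x _; rewrite /= big_cons EFinD.
    rewrite big_cons -ih2 -i2 -RintegralD//.
    by apply: eq_Rintegral => t _; rewrite big_cons.
  split; first by have := @integrableD _ _ _ mu _ (measurable_itv _) _ _ ci si; apply.
  by rewrite RintegralD // sI Rintegral_cst01.
have mP : measurable_fun (`[0, 1] : set R) (fun t => ln (normc (P (unit_circle t)))).
  rewrite (_ : (fun t => _) =
    fun t => ln (C * \prod_(w <- rs) normc (unit_circle t - w))); last first.
    by apply/funext => t; rewrite PE.
  apply: measurableT_comp => //; apply: measurable_funM => //.
  apply: measurable_prod => w _; apply: measurable_funTS.
  by apply: continuous_measurable_fun; exact: continuous_normc_unit_circleB.
have -> : \int[mu]_(t in `[0, 1]) ln (normc (P (unit_circle t))) = \int[mu]_(t in `[0, 1]) S t.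
  rewrite /Rintegral; congr fine; apply: ae_eq_integral => //.
  - by apply/measurable_EFinP; exact: mP.
  - by case/integrableP: Si.
  - have N : mu.-negligible
        [set t : R | `[0, 1]%classic t /\ exists2 w, w \in rs & unit_circle t = w].
      elim: rs {PE S Si SI} => [|w rs ih].
        by apply: negligibleS (negligible_set0 mu) => t [_ []].
      apply: negligibleS (negligibleU (unit_circle_fiber_negligible w) ih) => t [It [v]].
      rewrite inE => /orP[/eqP->|vrs] e; first by left.
      by right; split => //; exists v.
    apply: negligibleS N => t /= h.
    apply: contrapT => h'; apply: h => It; congr EFin.
    have ne w : w \in rs -> 0 < normc (unit_circle t - w).
      move=> wrs; rewrite normc_gt0 subr_eq0; apply/eqP => e; apply: h'; split => //.
      by exists w.
    rewrite PE lnM ?posrE //; last first.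
      by rewrite big_seq; apply: prodr_gt0 => w; exact: ne.
    rewrite /S; congr (_ + _).
    elim: rs ne {PE S Si SI h'} => [|w rs ih] ne; first by rewrite !big_nil ln1.
    rewrite !big_cons lnM ?posrE ?ih ?ne ?mem_head //.
      by move=> v vrs; apply: ne; rewrite inE vrs orbT.
    by rewrite big_seq; apply: prodr_gt0 => v vrs; apply: ne; rewrite inE vrs orbT.
rewrite SI expRD lnK ?posrE//; congr (_ * _).
rewrite expR_sum; apply: eq_bigr => w _.
by rewrite lnK // posrE lt_max ltr01.
Qed.

End JensenUnit.

(** * The matrix-tree theorem *)

Section MatrixTree.
Variables (n : nat) (E : finType) (en : E -> 'I_n * 'I_n) (r : 'I_n).
Let G := @Multigraph ('I_n) E en.
Local Notation joins := (@joins G).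
Local Notation choice_fun := {ffun 'I_n -> option (E * 'I_n)}.
Implicit Types (f g : choice_fun) (x y z v : 'I_n) (F : {set E}).

Lemma joinsC (e : E) x y : joins e x y = joins e y x.
Proof. by rewrite /Defs.joins orbC. Qed.

Lemma joins_ends (e : E) x y x' y' : joins e x y -> joins e x' y' ->
  (x' = x /\ y' = y) \/ (x' = y /\ y' = x).
Proof.
by rewrite /Defs.joins => /orP[]/eqP-> /orP[]/eqP[-> ->]; auto.
Qed.

(** A choice f selects at each vertex x an edge and its other end, or nothing;
    the second component keeps the orientation explicit, so that a vertex
    without selected edge is its own parent. *)
Definition parent f x := if f x is Some ez then ez.2 else x.

Definition admissible x (o : option (E * 'I_n)) :=
  if o is Some ez then (x != r) && joins ez.1 x ez.2 else x == r.

(** Spanning trees oriented towards the root r. *)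
Definition arborescence f :=
  [forall x, admissible x (f x)] && [forall x, fconnect (parent f) x r].

Lemma fconnect_closed f (A : pred 'I_n) x :
  (forall y, A y -> A (parent f y)) -> A x -> fconnect (parent f) x r -> A r.
Proof.
move=> cA Ax /iter_findex <-; elim: (findex _ _ _) => //= k; exact: cA.
Qed.

Lemma fconnect_parent f x : x != r ->
  fconnect (parent f) (parent f x) r = fconnect (parent f) x r.
Proof.
move=> xr; apply/idP/idP => [|h].
  by apply: connect_trans; exact: fconnect1.
move: xr; rewrite -(iter_findex h); case: (findex _ _ _) => [|k _]; first by rewrite eqxx.
by rewrite iterSr fconnect_iter.
Qed.

Lemma arborescence_root f : arborescence f -> f r = None.
Proof.
by case/andP => /forallP/(_ r); case: (f r) => //= ez; rewrite eqxx.
Qed.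

Lemma arborescence_child f x : arborescence f -> x != r ->
  exists e, f x = Some (e, parent f x) /\ joins e x (parent f x).
Proof.
case/andP => /forallP/(_ x) + _; rewrite /parent.
case: (f x) => [[e z]|] /=; last by move=> ->.
by move=> /andP[_ h] _; exists e.
Qed.

Section Determinant.
Variable K : comNzRingType.

(** The row of a choice is the term it selects in the row x of the rooted
    Laplacian, and zero if the choice is not available at x. *)
Definition choice_entry x (o : option (E * 'I_n)) j : K :=
  if admissible x o then (j == x)%:R - (if o is Some ez then (j == ez.2)%:R else 0)
  else 0.

Definition choice_matrix f : 'M[K]_n := \matrix_(x, j) choice_entry x (f x) j.

(** The Laplacian with the row of the root replaced by the basis vector of the
    root; its determinant is the principal minor at the root. *)
Definition rooted_laplacian : 'M[K]_n := \matrix_(x, j)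
  if x == r then (j == r)%:R
  else \sum_(ez : E * 'I_n | joins ez.1 x ez.2) ((j == x)%:R - (j == ez.2)%:R).

(** Each row is the sum of the rows of the choices at this vertex, so the
    determinant expands by multilinearity. *)
Lemma det_rooted_laplacian :
  \det rooted_laplacian = \sum_f \det (choice_matrix f).
Proof.
rewrite /determinant exchange_big /=; apply: eq_bigr => s _.
rewrite -mulr_sumr; congr (_ * _).
transitivity (\prod_x \sum_o choice_entry x o (s x)); last first.
  rewrite bigA_distr_bigA /=; apply: eq_bigr => f _.
  by apply: eq_bigr => x _; rewrite mxE.
apply: eq_bigr => x _; rewrite mxE.
rewrite (bigD1 None) //= (reindex_omap Some id) /=; last by case.
rewrite [choice_entry x None _]/choice_entry /=.
case: eqVneq => [->|xr].
  rewrite subr0 big1 ?addr0// => ez _.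
  by rewrite /choice_entry /= eqxx.
rewrite add0r big_mkcond /=; apply: eq_big => [ez|ez _]; first by rewrite eqxx.
by rewrite /choice_entry /= xr.
Qed.

Lemma det_kernel (A : 'M[K]_n) (v : 'cV[K]_n) i :
  A *m v = 0 -> v i 0 = 1 -> \det A = 0.
Proof.
move=> Av vi; have : (\adj A *m A *m v) i 0 = 0 by rewrite -mulmxA Av mulmx0 mxE.
by rewrite mul_adj_mx mul_scalar_mx mxE vi mulr1.
Qed.

(** If some vertices do not lead to the root, their indicator vector is in the
    kernel. If all do, a permutation s with nonzero contribution to the
    determinant sends each vertex to itself or to its parent, so a vertex that
    s moves would have all its ancestors moved, up to the root, which s fixes;
    only the identity contributes. *)
Lemma det_choice_matrix f : \det (choice_matrix f) = (arborescence f)%:R.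
Proof.
have [adm|] := boolP [forall x, admissible x (f x)]; last first.
  rewrite /arborescence => h; rewrite (negbTE h) /=.
  move: h; rewrite negb_forall => /existsP[x hx].
  rewrite /determinant big1 // => s _.
  by rewrite (bigD1 x) //= mxE /choice_entry (negbTE hx) mul0r mulr0.
rewrite /arborescence adm /=.
have [reach|] := boolP [forall x, fconnect (parent f) x r]; last first.
  rewrite negb_forall => /existsP[x0 hx0].
  pose v : 'cV[K]_n := \col_x (~~ fconnect (parent f) x r)%:R.
  apply: (@det_kernel _ v x0); last by rewrite mxE hx0.
  apply/matrixP => x j; rewrite mxE [RHS]mxE.
  have pick (z : 'I_n) : \sum_(i < n) (i == z)%:R * v i j = v z j.
    rewrite (bigD1 z) //= eqxx mul1r big1 ?addr0// => i /negbTE->.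
    by rewrite mul0r.
  under eq_bigr do rewrite mxE /choice_entry (forallP adm).
  under eq_bigr do rewrite mulrBl.
  rewrite sumrB pick; move: (forallP adm x).
  case fx: (f x) => [[e z]|] /=.
    have pz : parent f x = z by rewrite /parent fx.
    by move=> /andP[xr _]; rewrite pick !mxE -pz fconnect_parent // subrr.
  move=> /eqP->; rewrite mxE connect0 big1 ?subrr// => i _.
  by rewrite mul0r.
have arb : arborescence f by rewrite /arborescence adm.
rewrite /determinant (bigD1 1%g) //= odd_perm1 mul1r.
rewrite [X in X + _]big1; last first.
  move=> x _; rewrite perm1 mxE /choice_entry (forallP adm) eqxx.
  have [->|xr] := eqVneq x r; first by rewrite arborescence_root // subr0.
  have [e [fx _]] := arborescence_child arb xr; rewrite fx /=.
  suff /negbTE-> : x != parent f x by rewrite subr0.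
  apply/eqP => px; have := forallP reach x.
  move=> /(@fconnect_closed f (pred1 x) x) /= /(_ _ (eqxx x)) h.
  have /eqP rx : r == x by apply: h => y /eqP->; rewrite -px.
  by rewrite rx eqxx in xr.
rewrite [X in _ + X]big1 ?addr0// => s s1.
have [x sx] : exists x, s x != x.
  apply/existsP; apply: contraT; rewrite negb_exists => /forallP h.
  case/negP: s1; apply/eqP/permP => x; rewrite perm1.
  by apply/eqP; rewrite -[_ == _]negbK; exact: h.
have [p0|] := boolP [exists y, choice_matrix f y (s y) == 0].
  have /existsP[y /eqP y0] := p0.
  by rewrite (bigD1 y) //= y0 mul0r mulr0.
rewrite negb_exists => /forallP nz.
have step y : s y = y \/ s y = parent f y /\ y != r.
  have := nz y; rewrite mxE /choice_entry (forallP adm).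
  have := forallP adm y; rewrite /parent; case: (f y) => [[e z]|] /=.
    move=> /andP[yr _]; case: (eqVneq (s y) y) => [|_]; first by left.
    case: (eqVneq (s y) z) => [-> _|_]; first by right.
    by rewrite subrr eqxx.
  by move=> _; case: (eqVneq (s y) y) => [|_]; [left | rewrite subr0 eqxx].
have it k : iter k (parent f) x = iter k s x /\ iter k s x != r.
  have mv j : s (iter j s x) != iter j s x.
    by elim: j => [|j ih] //=; rewrite (inj_eq perm_inj).
  have nr j : iter j s x != r.
    by have [/eqP|[_ //]] := step (iter j s x); rewrite (negbTE (mv j)).
  split=> //; elim: k => //= k ->.
  by have [/eqP|[-> //]] := step (iter k s x); rewrite (negbTE (mv k)).
have [e1 e2] := it (findex (parent f) x r).
by rewrite -e1 iter_findex ?eqxx ?(forallP reach) in e2.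
Qed.

End Determinant.

Definition chosen_edges f : {set E} := [set e | [exists x, exists z, f x == Some (e, z)]].

Local Notation adj F := (fun u v => [exists e in F, joins e u v]).

Lemma chosen_edgesP f e :
  reflect (exists x, exists z, f x = Some (e, z)) (e \in chosen_edges f).
Proof.
rewrite inE; apply: (iffP existsP) => [[x /existsP[z /eqP h]]|[x [z h]]]; exists x.
  by exists z.
by apply/existsP; exists z; rewrite h.
Qed.

Lemma arborescence_joins f x e z : arborescence f -> f x = Some (e, z) ->
  joins e x z /\ z = parent f x.
Proof.
by case/andP => /forallP/(_ x) + _ fx; rewrite /parent fx => /andP[].
Qed.

(** Following the parents from any vertex leads to the root, so no nonempty
    set of other vertices is closed under parents. All the combinatorics of
    arborescences below rests on this. *)
Lemma arborescence_closed f (A : pred 'I_n) x : arborescence f ->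
  (forall y, A y -> y != r /\ A (parent f y)) -> ~ A x.
Proof.
case/andP => _ /forallP reach cA Ax.
by have [] := cA r (fconnect_closed (fun y Ay => proj2 (cA y Ay)) Ax (reach x)); rewrite eqxx.
Qed.

(** Two vertices selecting the same edge would be each other's parent. *)
Lemma arborescence_inj f x x' e z z' : arborescence f ->
  f x = Some (e, z) -> f x' = Some (e, z') -> x = x'.
Proof.
move=> arb fx fx'; have [jx pz] := arborescence_joins arb fx.
have [jx' pz'] := arborescence_joins arb fx'.
have [[-> //]|[xz zx]] := joins_ends jx jx'.
exfalso; apply: (@arborescence_closed f (pred2 x x') x arb); last by rewrite /= eqxx.
move=> y /orP[]/eqP->; split.
- by apply/eqP => xr; rewrite xr arborescence_root in fx.
- by rewrite -pz -xz /= eqxx orbT.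
- by apply/eqP => xr; rewrite xr arborescence_root in fx'.
- by rewrite -pz' zx /= eqxx.
Qed.

Lemma arborescence_connected f : arborescence f ->
  @connected_by G (chosen_edges f).
Proof.
move=> arb; have toroot x : connect (adj (chosen_edges f)) x r.
  have [_ /forallP/(_ x) /iter_findex <-] := andP arb.
  elim: (findex _ _ _) => [|k ih] /=; first exact: connect0.
  apply: connect_trans ih _; set y := iter k _ x.
  have [->|yr] := eqVneq y r; first by rewrite /parent arborescence_root.
  have [e [fy je]] := arborescence_child arb yr.
  apply: connect1; apply/existsP; exists e; rewrite je andbT.
  by apply/chosen_edgesP; exists y, (parent f y).
apply/forallP => x; apply/forallP => y; apply: connect_trans (toroot x) _.
rewrite (sym_connect_sym (e := adj _)) // => u v.
by apply: eq_existsb => e; rewrite joinsC.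
Qed.

(** Each edge of a cycle is selected by one of its ends, and different edges by
    different vertices. A cycle has as many edges as vertices, so all its
    vertices select edges of the cycle: they form a set closed under
    parents. *)
Lemma arborescence_acyclic f : arborescence f -> @acyclic G (chosen_edges f).
Proof.
move=> arb p; apply/negP => /and5P[p0 pF ue uv cyc].
pose X := [set x in [seq a.2 | a <- p]]; pose Y := [set e in [seq a.1 | a <- p]].
pose V := [set x | if f x is Some ez then ez.1 \in Y else false].
have ends (e : E) x y : e \in Y -> joins e x y -> x \in X /\ y \in X.
  rewrite inE => /mapP[[e' x'] ap /= ->] j.
  have := prev_cycle cyc ap => /= j'.
  have inX : x' \in X by rewrite inE; apply/mapP; exists (e', x').
  have inX' : (prev p (e', x')).2 \in X.
    by rewrite inE; apply/mapP; exists (prev p (e', x')); rewrite ?mem_prev.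
  by have [[-> ->]|[-> ->]] := joins_ends j' j.
have VX : V \subset X.
  apply/fintype.subsetP => x; rewrite inE; case fx: (f x) => [[e z]|] //= eY.
  have [j _] := arborescence_joins arb fx.
  by have [] := ends _ _ _ eY j.
have cXY : #|X| = #|Y| by rewrite !cardsE (card_uniqP ue) (card_uniqP uv) !size_map.
have YV : (#|Y| <= #|V|)%N.
  rewrite -(card_imset _ (@Some_inj _)).
  pose h x := omap (fun ez : E * 'I_n => ez.1) (f x).
  apply: leq_trans (leq_imset_card h _); apply: subset_leq_card.
  apply/fintype.subsetP => _ /imsetP[e eY ->].
  have : e \in chosen_edges f.
    by move: eY; rewrite inE => /mapP[a ap ->]; exact: (allP pF).
  by case/chosen_edgesP => x [z fx]; apply/imsetP; exists x; rewrite ?inE /h ?fx.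
have /eqP VE : V == X by rewrite eqEcard VX cXY.
have [x xX] : exists x, x \in X.
  case: p p0 @X {Y V ends pF ue uv cyc VX cXY YV VE} => // a p _.
  by exists a.2; rewrite inE mem_head.
apply: (@arborescence_closed f (mem X) x arb) => //= y; rewrite -{1}VE inE.
case fy: (f y) => [[e z]|] //= eY; have [j <-] := arborescence_joins arb fy.
split; last by have [] := ends _ _ _ eY j.
by apply/eqP => yr; rewrite yr arborescence_root in fy.
Qed.

(** The vertices where f and g differ form a set closed under the parents of g:
    the edge that g selects at such a vertex y is selected by f at another
    vertex, which can only be the parent of y under g. *)
Lemma chosen_edges_inj f g : arborescence f -> arborescence g ->
  chosen_edges f = chosen_edges g -> f = g.
Proof.
move=> arbf arbg fg; apply/ffunP => x; apply/eqP/negPn/negP => x0.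
apply: (@arborescence_closed g (fun y => f y != g y) x arbg) => // {x x0} y /= fgy.
have yr : y != r by apply: contraNneq fgy => ->; rewrite !arborescence_root.
split=> //; have [e [gy je]] := arborescence_child arbg yr.
have : e \in chosen_edges f by rewrite fg; apply/chosen_edgesP; exists y, (parent g y).
case/chosen_edgesP => w [z fw]; have [jw zE] := arborescence_joins arbf fw.
have wy : w != y.
  apply: contraNneq fgy => wy; rewrite -wy fw wy gy; apply/eqP; congr (Some (_, _)).
  by have [[_ ->]|[<- ->]] := joins_ends je jw; rewrite ?wy.
have -> : parent g y = w.
  by have [[wE _]|[-> _]] := joins_ends je jw; first rewrite wE eqxx in wy.
apply/eqP => fgw; rewrite fgw in fw.
by move: wy; rewrite (arborescence_inj arbg fw gy) eqxx.
Qed.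

(** Lifts a simple path of vertices to edges, in the form needed to close it to
    a cycle with one more edge. The edges are distinct because the first one
    has an end that the rest of the path avoids. *)
Lemma path_edges F x s : path (adj F) x s -> uniq (x :: s) ->
  exists p : seq (E * 'I_n), [/\ [seq a.2 | a <- p] = s,
    all (fun a => a.1 \in F) p, uniq [seq a.1 | a <- p],
    forall e0, path (fun a b => joins b.1 a.2 b.2) (e0, x) p &
    forall a y z, a \in p -> joins a.1 y z -> y \in x :: s].
Proof.
elim: s x => [|y s ih] x; first by move=> _ _; exists [::]; split.
move=> /= /andP[/existsP[e /andP[eF je]] /ih{}ih] /andP[xs /ih[p [ps pF pu pp pe]]].
exists ((e, y) :: p); split=> /=.
- by rewrite ps.
- by rewrite eF pF.
- rewrite pu andbT; apply: contra xs => /mapP[a ap ea].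
  by apply: (pe a x y) => //; rewrite -ea.
- by move=> _; rewrite je pp.
move=> a u v; rewrite inE => /orP[/eqP->/= j|ap j].
  by have [[-> _]|[-> _]] := joins_ends je j; rewrite !inE eqxx ?orbT.
by rewrite inE (pe a u v) ?orbT.
Qed.

(** An edge of F outside of F' would form a cycle with a path of F' between its
    ends. *)
Lemma acyclic_minimal F F' : @acyclic G F -> F' \subset F ->
  @connected_by G F' -> F' = F.
Proof.
move=> acF sF conF'; apply/eqP; rewrite finset.eqEsubset sF; apply/fintype.subsetP => e eF.
apply: contraT => eF'; case ee: (en e) => [a b].
have jab : joins e a b by rewrite /Defs.joins /= ee eqxx.
have /forallP/(_ b)/connectP[s0 ps0 ls0] := forallP conF' a.
case/shortenP: ps0 ls0 => s ps us _ ls.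
have [p [p2 pF pu pp pe]] := path_edges ps us.
have := acF ((e, a) :: p); rewrite /is_cycle /= eF.
rewrite (_ : all _ p); last first.
  by apply/allP => c /(allP pF); exact: (fintype.subsetP sF).
have -> : (a \notin [seq c.2 | c <- p]) && uniq [seq c.2 | c <- p] by rewrite p2.
have lp : (last (e, a) p).2 = b.
  by rewrite ls -p2 (last_map (fun c : E * 'I_n => c.2) p (e, a)).
rewrite pu rcons_path pp lp /= joinsC jab !andbT => /negP; case.
apply/mapP => -[c cp ec]; move: eF'; rewrite ec.
by rewrite (allP pF).
Qed.

Fixpoint walk_to_root F k x :=
  if k is k'.+1 then [exists y, adj F x y && walk_to_root F k' y] else x == r.

(** Each vertex selects an edge of F towards a vertex closer to the root. The
    edges selected connect the graph, hence are all of F by minimality. *)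
Lemma spanning_tree_arborescence F : @spanning_tree G F ->
  exists2 f, arborescence f & chosen_edges f = F.
Proof.
move=> [conF acF].
have wd x : exists k, walk_to_root F k x.
  have /forallP/(_ r)/connectP[s ps ls] := forallP conF x.
  exists (size s); elim: s x ps ls => [|y s ih] x /=; first by move=> _ ->.
  by move=> /andP[xy ps] ls; apply/existsP; exists y; rewrite xy ih.
pose dist x := ex_minn (wd x).
have closer x : x != r -> exists ez : E * 'I_n,
    [&& ez.1 \in F, joins ez.1 x ez.2 & (dist ez.2 < dist x)%N].
  rewrite {2}/dist; case: ex_minnP => -[|k] /=; first by move=> ->.
  move=> /existsP[y /andP[/existsP[e /andP[eF je]] hy]] _ _.
  exists (e, y); rewrite eF je /= ltnS /dist; case: ex_minnP => m _; exact.
pose f : choice_fun := [ffun x => if x == r then None else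
  [pick ez : E * 'I_n | [&& ez.1 \in F, joins ez.1 x ez.2 & (dist ez.2 < dist x)%N]]].
have fP x : x != r ->
    exists e z, [/\ f x = Some (e, z), e \in F, joins e x z & (dist z < dist x)%N].
  move=> xr; rewrite ffunE (negbTE xr); case: pickP => [[e z] /and3P[]|h].
    by exists e, z.
  by have [ez] := closer x xr; rewrite h.
have fr : f r = None by rewrite ffunE eqxx.
have arb : arborescence f.
  apply/andP; split; apply/forallP => x.
    have [->|xr] := eqVneq x r; first by rewrite fr /= eqxx.
    by have [e [z [-> _ j _]]] := fP x xr; rewrite /= xr.
  have [k] := ubnP (dist x); elim: k x => // k ih x.
  have [->|xr] := eqVneq x r; first by rewrite connect0.
  rewrite ltnS -fconnect_parent // => dk; apply: ih.
  by have [e [z [fx _ _ dz]]] := fP x xr; rewrite /parent fx (leq_trans dz).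
exists f => //; apply: acyclic_minimal => //; last exact: arborescence_connected.
apply/fintype.subsetP => e /chosen_edgesP[x [z fx]].
have xr : x != r by apply: contra_eq_neq fx => ->; rewrite fr.
by have [e' [z' [+ eF _ _]]] := fP x xr; rewrite fx => -[-> _].
Qed.

Lemma card_arborescences : #|[set f | arborescence f]| = nb_spanning_trees G.
Proof.
rewrite /nb_spanning_trees -(@card_in_imset _ _ chosen_edges); last first.
  by move=> f g; rewrite !inE; exact: chosen_edges_inj.
apply: eq_card => F; rewrite [RHS]inE; apply/imsetP/asboolP.
  move=> [f]; rewrite inE => arb ->.
  by split; [exact: arborescence_connected | exact: arborescence_acyclic].
by case/spanning_tree_arborescence => f arb <-; exists f; rewrite ?inE.
Qed.

(** Kirchhoff's theorem, the root being arbitrary. *)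
Theorem matrix_tree (K : comNzRingType) :
  \det (rooted_laplacian K) = (nb_spanning_trees G)%:R.
Proof.
rewrite det_rooted_laplacian -card_arborescences -sum1_card natr_sum [RHS]big_mkcond /=.
apply: eq_bigr => f _; rewrite det_choice_matrix inE.
by case: arborescence.
Qed.

End MatrixTree.

(** * Laplacian spectrum of circulant graphs *)

Section Spectrum.

Section Bordered.
Variables (K : comNzRingType) (n : nat).
Local Notation one_col := (const_mx 1 : 'cV[K]_n).
Local Notation one_row := (const_mx 1 : 'rV[K]_n).

Lemma one_row_col : one_row *m one_col = n%:R%:M.
Proof.
rewrite [LHS]mx11_scalar; congr _%:M; rewrite mxE.
by under eq_bigr do rewrite !mxE mulr1; rewrite sumr_const card_ord.
Qed.

(** Schur complement: the matrix is [n + 1, -1; 0, I] [1, 0; 1, I]. *)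
Lemma det_border_col : \det (block_mx 1%:M (- one_row) one_col 1%:M) = n.+1%:R.
Proof.
have -> : block_mx 1%:M (- one_row) one_col 1%:M
    = block_mx n.+1%:R%:M (- one_row) 0 1%:M *m block_mx 1%:M 0 one_col 1%:M.
  rewrite mulmx_block !mulmx1 !mulmx0 !mul1mx !add0r mulNmx one_row_col.
  by rewrite -raddfB /= -natr1 addrAC subrr add0r.
by rewrite det_mulmx det_ublock det_lblock !det1 !mulr1 det_scalar1.
Qed.

Lemma det_border_row : \det (block_mx 1%:M one_row (- one_col) 1%:M) = n.+1%:R.
Proof.
rewrite -det_tr tr_block_mx !trmx1 !raddfN /= !trmx_const; exact: det_border_col.
Qed.

(** With vanishing row and column sums, L is determined by its lower right
    block L', and L + J = [1, -1; 1, I] diag(1, L') [1, 1; -1, I]. *)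
Lemma det_add_const_mx (L : 'M[K]_(1 + n)) :
  L *m (const_mx 1 : 'cV[K]_(1 + n)) = 0 -> (const_mx 1 : 'rV[K]_(1 + n)) *m L = 0 ->
  \det (L + const_mx 1) = n.+1%:R ^+ 2 * \det (drsubmx L).
Proof.
rewrite -{1 2 3}(submxK L); set a := ulsubmx L; set b := ursubmx L.
set b' := dlsubmx L; set L' := drsubmx L.
rewrite -col_mx_const mul_block_col -row_mx_const mul_row_block.
rewrite -[X in col_mx _ _ = X -> _]col_mx0 -[X in _ -> row_mx _ _ = X -> _]row_mx0.
move=> /eq_col_mx[_ h1] /eq_row_mx[h2 h3].
have one11 : const_mx 1 = 1%:M :> 'M[K]_1 by apply/matrixP => i j; rewrite !ord1 !mxE.
rewrite one11 ?mulmx1 ?mul1mx in h1 h2 h3.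
have {h1}b'E : b' = - (L' *m one_col) by apply/eqP; rewrite -addr_eq0 h1.
have {h3}bE : b = - (one_row *m L') by apply/eqP; rewrite -addr_eq0 h3.
have {h2}aE : a = one_row *m L' *m one_col.
  by apply/eqP; rewrite -subr_eq0 -mulmxA -mulmxN -b'E h2.
rewrite -(block_mx_const 1 n 1 n) one11 add_block_mx.
have -> : block_mx (a + 1%:M) (b + one_row) (b' + one_col) (L' + const_mx 1)
   = block_mx 1%:M (- one_row) one_col 1%:M *m block_mx 1%:M 0 0 L'
     *m block_mx 1%:M one_row (- one_col) 1%:M.
  have one2 : one_col *m one_row = const_mx 1 :> 'M[K]_n.
    by apply/matrixP => i j; rewrite mxE big_ord1 !mxE mulr1.
  rewrite !mulmx_block ?(mulmx1, mulmx0, mul0mx, mul1mx, addr0, add0r).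
  rewrite !mulmxN !mulNmx opprK one2 aE bE b'E.
  by congr block_mx; rewrite addrC.
rewrite !det_mulmx det_border_col det_border_row det_lblock det1 mul1r.
by rewrite mulrAC.
Qed.

End Bordered.

Section Laplacian.
Variables (K : comNzRingType) (n : nat) (E : finType) (en : E -> 'I_n.+1 * 'I_n.+1).
Let G := @Multigraph 'I_n.+1 E en.

Definition laplacian : 'M[K]_(1 + n) := \matrix_(x, j)
  \sum_(ez : E * 'I_n.+1 | @joins G ez.1 x ez.2) ((j == x)%:R - (j == ez.2)%:R).

(** The Laplacian as a difference operator on functions of the vertices. *)
Lemma laplacian_mul (v : 'I_n.+1 -> K) x :
  \sum_j laplacian x j * v j =
  \sum_z (v x - v z) *+ #|[set e : E | @joins G e x z]|.
Proof.
have pick (z : 'I_n.+1) : \sum_j (j == z)%:R * v j = v z.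
  rewrite (bigD1 z) //= eqxx mul1r big1 ?addr0// => i /negbTE->.
  by rewrite mul0r.
under eq_bigr do rewrite mxE mulr_suml.
rewrite exchange_big /=.
under eq_bigr => ez _.
  under eq_bigr do rewrite mulrBl.
  rewrite sumrB !pick; over.
rewrite (eq_bigr (fun ez => (fun e z => v x - v z) ez.1 ez.2)) //.
rewrite -(pair_big_dep xpredT (fun e z => @joins G e x z) (fun e z => v x - v z)) /=.
rewrite (exchange_big_dep xpredT) //=; apply: eq_bigr => z _.
by rewrite sumr_const; congr (_ *+ _); apply: eq_card => e; rewrite !inE.
Qed.

Lemma laplacian_row_sums : laplacian *m (const_mx 1 : 'cV[K]_(1 + n)) = 0.
Proof.
apply/matrixP => x i; rewrite mxE [RHS]mxE.
under eq_bigr do rewrite [const_mx _ _ _]mxE.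
by rewrite (laplacian_mul (fun=> 1)) big1 // => z _; rewrite subrr mul0rn.
Qed.

Lemma laplacian_sym : laplacian^T = laplacian.
Proof.
have delta (v : 'I_n.+1) x : laplacian x v = \sum_j laplacian x j * (j == v)%:R.
  rewrite (bigD1 v) //= eqxx mulr1 big1 ?addr0// => i /negbTE->.
  by rewrite mulr0.
apply/matrixP => x y; rewrite mxE; have [->//|xy] := eqVneq x y.
rewrite !delta !laplacian_mul.
rewrite (bigD1 x) //= [X in _ + X]big1 => [|z zx]; last first.
  by rewrite (negbTE zx) eq_sym (negbTE xy) subrr mul0rn.
rewrite [RHS](bigD1 y) //= [X in _ = _ + X]big1 => [|z zx]; last first.
  by rewrite (negbTE zx) (negbTE xy) subrr mul0rn.
rewrite !eqxx eq_sym (negbTE xy); congr (_ *+ _ + _).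
by apply: eq_card => e; rewrite !inE joinsC.
Qed.

Lemma laplacian_col_sums : (const_mx 1 : 'rV[K]_(1 + n)) *m laplacian = 0.
Proof.
by apply: trmx_inj; rewrite trmx_mul laplacian_sym trmx_const laplacian_row_sums trmx0.
Qed.

Lemma det_rooted_laplacianE :
  \det (rooted_laplacian en ord0 K) = \det (drsubmx laplacian).
Proof.
rewrite -[rooted_laplacian _ _ _](@submxK _ 1 n 1 n).
have -> : ursubmx (rooted_laplacian en ord0 K : 'M[K]_(1 + n)) = 0.
  by apply/matrixP => i j; rewrite !ord1 !mxE.
have -> : ulsubmx (rooted_laplacian en ord0 K : 'M[K]_(1 + n)) = 1%:M.
  by apply/matrixP => i j; rewrite !ord1 !mxE.
rewrite (@det_lblock _ 1 n) det1 mul1r; congr (\det _).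
by apply/matrixP => i j; rewrite !mxE.
Qed.

(** Adding the all-ones matrix J moves the eigenvalue 0 of the constants to the
    number of vertices and leaves the others unchanged, so that the number of
    spanning trees is read off a nonsingular matrix. *)
Lemma det_laplacian_add :
  \det (laplacian + const_mx 1) = n.+1%:R ^+ 2 * (nb_spanning_trees G)%:R.
Proof.
rewrite det_add_const_mx ?laplacian_row_sums ?laplacian_col_sums //.
by rewrite -det_rooted_laplacianE matrix_tree.
Qed.

End Laplacian.

Section Fourier.
Variables (K : fieldType) (n : nat) (zeta : K).
Hypothesis zetaP : n.+1.-primitive_root zeta.

(** The eigenvectors are the columns of the discrete Fourier matrix, which is
    the invertible Vandermonde matrix of the powers of zeta. *)
Lemma det_eigen (A : 'M[K]_n.+1) (mu : 'I_n.+1 -> K) :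
  (forall x j : 'I_n.+1,
     \sum_y A x y * (zeta ^+ j) ^+ y = mu j * (zeta ^+ j) ^+ x) ->
  \det A = \prod_j mu j.
Proof.
move=> Amu; pose F := Vandermonde n.+1 (\row_(j < n.+1) zeta ^+ j).
have F0 : \det F != 0.
  rewrite det_Vandermonde; apply/prodf_neq0 => i _; apply/prodf_neq0 => j ij.
  rewrite !mxE subr_eq0 (eq_prim_root_expr zetaP) !modn_small //.
  by rewrite gtn_eqF.
apply: (mulIf F0); rewrite -det_mulmx.
have -> : A *m F = F *m diag_mx (\row_j mu j).
  apply/matrixP => x j; rewrite mul_mx_diag !mxE mulrC -Amu.
  by apply: eq_bigr => y _; rewrite !mxE.
rewrite det_mulmx det_diag mulrC; congr (_ * _).
by apply: eq_bigr => j _; rewrite mxE.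
Qed.

Lemma sum_prim_root_expr (j : 'I_n.+1) :
  \sum_(y < n.+1) (zeta ^+ j) ^+ y = (j == ord0)%:R * n.+1%:R.
Proof.
case: eqVneq => [->|j0].
  by under eq_bigr do rewrite expr0 expr1n; rewrite sumr_const card_ord mul1r.
have : (zeta ^+ j - 1) * \sum_(y < n.+1) (zeta ^+ j) ^+ y = 0.
  by rewrite -subrX1 exprAC (prim_expr_order zetaP) expr1n subrr.
move/eqP; rewrite mulf_eq0 mul0r => /orP[|/eqP//].
rewrite subr_eq0 -(expr0 zeta) (eq_prim_root_expr zetaP) !modn_small // => /eqP j0'.
by case/eqP: j0; apply: val_inj.
Qed.

End Fourier.

(** The vector of the powers of zeta^j is an eigenvector of the Laplacian: the
    jump a multiplies it by zeta^(j a) one way and by its inverse the other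
    way. The hypothesis on the jumps ensures that no step is a loop. *)
Lemma circulant_trees (K : numFieldType) (n : nat) (c : seq nat) (zeta : K) :
  n.+1.-primitive_root zeta -> all (fun a => 0 < a < n.+1)%N c ->
  n.+1%:R * (nb_spanning_trees (circulant n.+1 c))%:R =
  \prod_(j < n.+1 | j != ord0) \sum_(a <- c) (2 - zeta ^+ (j * a) - zeta ^- (j * a)).
Proof.
move=> zP c_bnd.
pose mu (j : 'I_n.+1) := \sum_(a <- c) (2 - zeta ^+ (j * a) - zeta ^- (j * a)).
pose L := laplacian K (@ends (circulant n.+1 c)).
have Lmu (x j : 'I_n.+1) : \sum_y L x y * (zeta ^+ j) ^+ y = mu j * (zeta ^+ j) ^+ x.
  rewrite (laplacian_mul _ (fun y : 'I_n.+1 => (zeta ^+ j) ^+ y)).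
  have uN : (zeta ^+ j) ^+ n.+1 = 1 by rewrite exprAC (prim_expr_order zP) expr1n.
  have u0 : zeta ^+ j != 0.
    by apply: contra_eq_neq uN => ->; rewrite expr0n eq_sym oner_eq0.
  set u := zeta ^+ j in uN u0 *.
  transitivity (\sum_z \sum_(je | circulant_step (c := c) x z je) (u ^+ x - u ^+ z)).
    apply: eq_bigr => z _; have [->|zx] := eqVneq z x.
      by rewrite subrr mul0rn big1.
    rewrite sumr_const; congr (_ *+ _).
    have xz : x != z by rewrite eq_sym.
    by rewrite (circulant_multiplicity c xz) cardsE.
  rewrite (exchange_big_dep xpredT) //= /mu (big_nth 0%N) big_mkord.
  rewrite mulr_suml (eq_bigr (fun je => (fun i b =>
     \sum_(z | circulant_step (c := c) x z (i, b)) (u ^+ x - u ^+ z)) je.1 je.2));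
    last by case.
  rewrite -(pair_big xpredT xpredT (fun i b =>
     \sum_(z | circulant_step (c := c) x z (i, b)) (u ^+ x - u ^+ z))) /=.
  apply: eq_bigr => i _; set a := nth 0%N c i.
  have /andP[a0 aN] : (0 < a < n.+1)%N by apply: (allP c_bnd); rewrite mem_nth.
  pose up : 'I_n.+1 := inord ((x + a) %% n.+1)%N.
  pose down : 'I_n.+1 := inord ((x + (n.+1 - a)) %% n.+1)%N.
  have upE : up = ((x + a) %% n.+1)%N :> nat by rewrite inordK // ltn_pmod.
  have downE : down = ((x + (n.+1 - a)) %% n.+1)%N :> nat by rewrite inordK // ltn_pmod.
  rewrite (bigD1 true) //= (bigD1 false) //= [X in _ + (_ + X)]big1 ?addr0; last by case.
  rewrite (big_pred1 up); last first.
    by move=> z; rewrite /circulant_step /= -val_eqE /= upE modn_small.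
  rewrite (big_pred1 down); last first.
    move=> z; rewrite /circulant_step /= -val_eqE /= downE.
    rewrite -[X in _ = (X == _)](modn_small (ltn_ord z)) -[RHS](eqn_modDr a) -addnA.
    by rewrite subnK ?(ltnW aN) // modnDr.
  rewrite upE downE !expr_mod // !exprD exprB ?unitfE ?(ltnW aN) // uN mul1r.
  by rewrite !exprM -/u; ring.
have eqd : n.+1%:R ^+ 2 * (nb_spanning_trees (circulant n.+1 c))%:R
    = \prod_j (mu j + (j == ord0)%:R * n.+1%:R).
  transitivity (\det (L + const_mx 1)); first by rewrite det_laplacian_add.
  apply: (det_eigen zP) => x j; rewrite mulrDl -Lmu.
  under eq_bigr do rewrite mxE mulrDl [const_mx _ _ _]mxE mul1r.
  rewrite big_split /= (sum_prim_root_expr zP); congr (_ + _).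
  by case: eqVneq => [->|]; rewrite ?mul0r // expr0 expr1n mulr1.
have N0 : n.+1%:R != 0 :> K by rewrite pnatr_eq0.
apply: (mulfI N0); rewrite mulrA -expr2 eqd (bigD1 ord0) //= ?eqxx mul1r.
rewrite /mu big1 => [|a _]; last by rewrite mul0n expr0 invr1; ring.
rewrite add0r; congr (_ * _); apply: eq_bigr => j /negbTE->.
by rewrite mul0r addr0.
Qed.

End Spectrum.

(** * Products over the n-th roots of a point of the circle *)

Section RootProducts.
Variables (K : fieldType) (n : nat) (omega : K).
Hypotheses (n0 : (0 < n)%N) (omegaP : n.-primitive_root omega).

Lemma prod_twisted_roots (w y : K) :
  \prod_(0 <= t < n) (w - y * omega ^+ t) = w ^+ n - y ^+ n.
Proof.
have [->|y0] := eqVneq y 0.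
  rewrite expr0n -[(n == 0)%N]negbK -lt0n n0 subr0.
  by under eq_bigr do rewrite mul0r subr0; rewrite prodr_const_nat subn0.
have h : \prod_(0 <= t < n) (w / y - omega ^+ t) = (w / y) ^+ n - 1.
  have := congr1 (fun p => p.[w / y]) (factor_Xn_sub_1 omegaP).
  rewrite horner_prod !hornerE => <-.
  by apply: eq_bigr => t _; rewrite !hornerE.
transitivity (y ^+ n * ((w / y) ^+ n - 1)).
  rewrite -h -[y ^+ n](_ : \prod_(0 <= t < n) y = _); last first.
    by rewrite prodr_const_nat subn0.
  rewrite -big_split /=; apply: eq_bigr => t _.
  by rewrite mulrBr mulrCA divff // mulr1.
by rewrite mulrBr mulr1 -exprMn mulrCA divff // mulr1.
Qed.

Lemma prod_one_sub_roots : \prod_(1 <= t < n) (1 - omega ^+ t) = n%:R.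
Proof.
have h := factor_Xn_sub_1 omegaP.
rewrite big_ltn // expr0 subrX1 in h.
have X1 : 'X - 1%:P != 0 :> {poly K} by rewrite polyXsubC_eq0.
have := congr1 (fun p => p.[1]) (mulfI X1 h).
rewrite horner_prod horner_sum.
under [X in _ = X -> _]eq_bigr do rewrite hornerXn expr1n.
rewrite sumr_const card_ord => <-.
by apply: eq_bigr => t _; rewrite !hornerE.
Qed.

End RootProducts.

(** Splits a product over residues u modulo b and quotients t. *)
Lemma prod_blocks (K : comNzRingType) (b n : nat) (F : nat -> K) :
  \prod_(0 <= j < b * n) F j = \prod_(0 <= t < n) \prod_(0 <= u < b) F (u + b * t)%N.
Proof.
elim: n => [|n ih]; first by rewrite muln0 !big_geq.
rewrite big_nat_recr //= -ih mulnS addnC (big_cat_nat _ (n := b * n)) //= ?leq_addr //.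
by congr (_ * _); rewrite -{1}[(b * n)%N]add0n big_addn addKn.
Qed.

Section Growth.
Variable R : realType.
Local Open Scope classical_set_scope.
Local Open Scope ring_scope.
Local Open Scope complex_scope.
Import ComplexField.Normc.

Lemma cvg_near_eq (F : set_system nat) {FF : Filter F} (f g : nat -> R) (l : R) :
  {near F, f =1 g} -> f @ F --> l -> g @ F --> l.
Proof. by move=> fg fl; apply: (cvg_trans _ fl); exact: near_eq_cvg. Qed.

Lemma prim_unit_circle n : (0 < n)%N ->
  n.-primitive_root (unit_circle n%:R^-1 : R[i]).
Proof.
move=> n0; apply/andP; split=> //; apply/forallP => i.
rewrite unity_rootE -unit_circleX; apply/eqP; apply/eqP/eqP => [h|->]; last first.
  by rewrite divff ?unit_circle1 // pnatr_eq0 -lt0n.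
apply/eqP; rewrite eqn_leq ltn_ord leqNgt; apply/negP => lt.
have n0' : 0 < n%:R :> R by rewrite ltr0n.
have : i.+1%:R / n%:R = 0 :> R.
  apply: unit_circle_eq1 h; rewrite ltr_pdivrMr // mul1r ltr_nat lt andbT.
  by rewrite (lt_le_trans _ (_ : 0 <= _)) ?divr_ge0 // oppr_lt0.
by move/eqP; rewrite mulf_eq0 invr_eq0 !pnatr_eq0 /= -leqn0 leqNgt n0.
Qed.

(** The ratio differs from 1 by at most rho^n, where rho < 1 is the smaller one
    of |w| and 1 / |w|. *)
Lemma growth_ratio (w eta : R[i]) : normc eta = 1 -> normc w != 1 ->
  (fun n => normc (w ^+ n - eta) / Num.max 1 (normc w) ^+ n) @ \oo --> (1 : R).
Proof.
move=> eta1 w1.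
have squeeze (f : nat -> R) (rho : R) : 0 <= rho < 1 ->
    (forall n, 1 - rho ^+ n <= f n <= 1 + rho ^+ n) -> f @ \oo --> (1 : R).
  move=> /andP[r0 r1] h.
  have rc : (fun n => rho ^+ n) @ \oo --> (0 : R) by apply: cvg_expr; rewrite ger0_norm.
  apply: (@squeeze_cvgr _ _ _ _ (fun n => 1 - rho ^+ n) (fun n => 1 + rho ^+ n)).
  - by apply: nearW.
  - by rewrite -[X in _ --> X]subr0; apply: cvgB => //; exact: cvg_cst.
  - by rewrite -[X in _ --> X]addr0; apply: cvgD => //; exact: cvg_cst.
move: w1; rewrite neq_lt => /orP[w1|w1].
  apply: (squeeze _ (normc w)); first by rewrite normc_ge0.
  move=> n; rewrite max_l ?(ltW w1) // expr1n divr1.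
  apply/andP; split.
    by rewrite -normcX -eta1 normcB; exact: le_normcB.
  by rewrite -normcX -eta1 addrC -(normcN eta); exact: le_normcD.
have w0 : 0 < normc w by rewrite (lt_trans _ w1).
apply: (squeeze _ (normc w)^-1); first by rewrite invr_ge0 ltW //= invf_lt1.
move=> n; rewrite max_r ?(ltW w1) // exprVn.
have p : 0 < normc w ^+ n by rewrite exprn_gt0.
apply/andP; split.
  rewrite ler_pdivlMr // mulrBl mul1r mulVf ?gt_eqF // -normcX -eta1; exact: le_normcB.
rewrite ler_pdivrMr // mulrDl mul1r mulVf ?gt_eqF // -normcX -eta1 -(normcN eta).
exact: le_normcD.
Qed.

(** The points e((theta + t) / n) are the n-th roots of eta = e(theta), so the
    factor z - w contributes |w^n - eta|. *)
Lemma root_product_growth (C theta : R) (rs : seq R[i]) : 0 < C ->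
  all (fun w => normc w != 1) rs ->
  (fun n => (\prod_(0 <= t < n)
       (C * \prod_(w <- rs) normc (unit_circle ((theta + t%:R) / n%:R) - w)))
     / (C * \prod_(w <- rs) Num.max 1 (normc w)) ^+ n) @ \oo --> (1 : R).
Proof.
move=> C0 rs1; set eta : R[i] := unit_circle theta.
pose f n := \prod_(w <- rs) (normc (w ^+ n - eta) / Num.max 1 (normc w) ^+ n).
have fc : f @ \oo --> (1 : R).
  rewrite /f; elim: rs rs1 {f} => [|w rs ih] /=.
    by under eq_fun do rewrite big_nil; move=> _; exact: cvg_cst.
  move=> /andP[w1 /ih{}ih].
  have h := cvgM (growth_ratio (normc_unit_circle theta) w1) ih; rewrite mulr1 in h.
  apply: cvg_near_eq (h _); apply: nearW => n.
  by rewrite big_cons.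
apply: cvg_near_eq fc; near=> n; apply: esym.
have n0 : (0 < n)%N by near: n; exact: nbhs_infty_gt.
have nR : n%:R != 0 :> R by rewrite pnatr_eq0 -lt0n.
rewrite big_split /= prodr_const_nat subn0 exchange_big /= exprMn.
rewrite invfM mulrACA divff ?expf_neq0 ?gt_eqF // mul1r.
rewrite -prodrXl -prodfV -big_split /=; apply: eq_bigr => w _; congr (_ / _).
have := prod_twisted_roots n0 (prim_unit_circle n0) w (unit_circle (theta / n%:R)).
rewrite -unit_circleX mulrCA divff // mulr1 -/eta => <-.
rewrite normc_prod; apply: eq_bigr => t _; rewrite normcB.
by rewrite mulrDl unit_circleD unit_circleX.
Unshelve. all: by end_near.
Qed.

End Growth.

(** * Zeros of the symbol on the unit circle *)

Section Symbol.
Variable R : realType.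
Local Open Scope complex_scope.
Import ComplexField.Normc.

Lemma two_sub_unit (z : R[i]) : normc z = 1 ->
  2 - z - z^-1 = (normc (1 - z) ^+ 2)%:C.
Proof.
move=> z1; have zz : z * conjc z = 1.
  by rewrite -sqr_normc [`|z|](_ : _ = (normc z)%:C) // z1 expr1n.
have z0 : z != 0 by rewrite -normc_gt0 z1.
have cz : conjc z = z^-1 by apply: (mulfI z0); rewrite zz divff.
have c1z : conjc (1 - z) = 1 - z^-1.
  by rewrite rmorphB rmorph1; congr (_ - _); exact: cz.
rewrite rmorphXn /= -[(normc _)%:C]/(`|1 - z|) sqr_normc c1z.
by rewrite mulrBl mul1r mulrBr mulr1 divff //; ring.
Qed.

Lemma sin_pi_unit_circle (x : R) :
  4 * sin (pi * x) ^+ 2 = normc (1 - unit_circle x) ^+ 2.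
Proof.
rewrite /unit_circle /normc /= sqr_sqrtr ?addr_ge0 ?sqr_ge0 //.
have := cos2Dsin2 (2 * pi * x).
rewrite -mulrA mulr_natl cos_mulr2n sin_mulr2n.
have := cos2Dsin2 (pi * x); set c := cos _; set s := sin _ => h _.
have -> : s ^+ 2 = 1 - c ^+ 2 by rewrite -h; ring.
have -> : (0 - (c * s) *+ 2) ^+ 2 = 4 * c ^+ 2 * s ^+ 2 by ring.
have -> : s ^+ 2 = 1 - c ^+ 2 by rewrite -h; ring.
by ring.
Qed.

(** The constant term 4 sum_m sin^2 (pi u alpha_m / beta), written in a form
    from which its zeros can be read. *)
Definition coupling (beta : nat) (alpha : seq nat) (u : nat) : R :=
  \sum_(a <- alpha) normc (1 - unit_circle ((u * a)%:R / beta%:R)) ^+ 2.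

Lemma coupling_ge0 beta alpha u : 0 <= coupling beta alpha u.
Proof. by apply: sumr_ge0 => a _; exact: sqr_ge0. Qed.

(** For |z| = 1, 2 - z^a - z^(-a) = (1 - z^a) (1 - conj z^a). *)
Lemma circulant_poly_unit beta (s alpha : seq nat) u (z : R[i]) : normc z = 1 ->
  circulant_poly beta s alpha u z =
  (\sum_(a <- s) normc (1 - z ^+ a) ^+ 2 + coupling beta alpha u)%:C.
Proof.
move=> z1; rewrite /circulant_poly rmorphD; congr (_ + _); last first.
  congr (_%:C); rewrite mulr_sumr; apply: eq_bigr => a _.
  by rewrite -sin_pi_unit_circle natrM !mulrA.
rewrite (rmorph_sum (@real_complex R)) /=.
transitivity (\sum_(a <- s) (2 - z ^+ a - z ^- a)).
  elim: s => [|a s ih]; first by rewrite !big_nil mulr0 subr0.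
  by rewrite !big_cons -ih /= -natr1; ring.
apply: eq_bigr => a _; rewrite two_sub_unit // normcX z1 expr1n //.
Qed.


Lemma poly_normc_factor (p : {poly R[i]}) :
  (forall z, normc z = 1 -> p.[z] != 0) ->
  exists (C : R) (rs : seq R[i]), [/\ 0 < C, all (fun w => normc w != 1) rs &
    forall z, normc p.[z] = C * \prod_(w <- rs) normc (z - w)].
Proof.
move=> p1; have [rs pE] := closed_field_poly_normal p.
have pev z : normc p.[z] = normc (lead_coef p) * \prod_(w <- rs) normc (z - w).
  rewrite [in LHS]pE hornerZ horner_prod normcM normc_prod; congr (_ * _).
  by apply: eq_bigr => w _; rewrite !hornerE.
exists (normc (lead_coef p)), rs; split=> //.
  rewrite normc_gt0 lead_coef_eq0; apply: contraTneq (p1 1 (normc1 R)) => ->.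
  by rewrite horner0 eqxx.
apply/allP => w wrs; apply/eqP => w1; have /eqP := p1 w w1; apply.
apply: eq0_normc; rewrite pev (perm_big _ (perm_to_rem wrs)) big_cons.
by rewrite subrr normc0 /= mul0r mulr0.
Qed.

Lemma expr_biggcd (K : fieldType) (z : K) (s : seq nat) :
  (exists2 a, a \in s & 0 < a)%N -> {in s, forall a, z ^+ a = 1} ->
  z ^+ (\big[gcdn/0]_(a <- s) a)%N = 1.
Proof.
move=> [b bs b0] h; have [m mP _] := prim_order_exists b0 (h b bs).
apply/eqP; rewrite -(prim_order_dvd mP) big_seq.
apply: (big_ind (fun x => m %| x)%N) => [|x y hx hy|a /h /eqP].
- exact: dvdn0.
- by rewrite dvdn_gcd hx.
- by rewrite -(prim_order_dvd mP).
Qed.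

Lemma biggcd_dvd (s : seq nat) a : a \in s -> (\big[gcdn/0]_(b <- s) b %| a)%N.
Proof.
elim: s => // b s ih; rewrite inE big_cons => /orP[/eqP->|/ih h].
  exact: dvdn_gcdl.
by apply: dvdn_trans h; exact: dvdn_gcdr.
Qed.

Section Factorization.
Variables (beta : nat) (s alpha : seq nat) (d q : nat).
Hypotheses (s0 : s != [::]) (s_ge1 : all (fun a => 1 <= a)%N s).
Hypothesis d_def : d = (\big[gcdn/0]_(a <- s) a)%N.
Hypothesis q_def : q = (\sum_(a <- s) a ^ 2)%N.

Lemma gcd_jumps_gt0 : (0 < d)%N.
Proof.
case: s s0 s_ge1 d_def => // a s' _ /= /andP[a0 _] ->.
by rewrite big_cons gcdn_gt0 a0.
Qed.

Lemma sum_sqr_jumps_gt0 : (0 < q)%N.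
Proof.
case: s s0 s_ge1 q_def => // a s' _ /= /andP[a0 _] ->.
by rewrite big_cons addn_gt0 expn_gt0 a0.
Qed.

(* Multiplying by z^S turns the Laurent polynomial into a polynomial. Any
   exponent that bounds all the jumps and is a multiple of d would do. *)
Let S := (\sum_(a <- s) a)%N.

Let leS a : a \in s -> (a <= S)%N.
Proof. by move=> as_; rewrite /S (big_rem a) //= leq_addr. Qed.

(** A positive constant term bounds the symbol from below on the circle. *)
Lemma symbol_factor_coupled u : 0 < coupling beta alpha u ->
  exists (C : R) (rs : seq R[i]), [/\ 0 < C, all (fun w => normc w != 1) rs &
    forall z, normc z = 1 ->
      normc (circulant_poly beta s alpha u z) = C * \prod_(w <- rs) normc (z - w)].
Proof.
move=> W0; pose p : {poly R[i]} := \sum_(a <- s) (2%:P * 'X^S - 'X^(S + a) - 'X^(S - a))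
   + ((coupling beta alpha u)%:C)%:P * 'X^S.
have pE z : normc z = 1 -> p.[z] = z ^+ S * circulant_poly beta s alpha u z.
  move=> z1; have z0 : z != 0 by rewrite -normc_gt0 z1.
  rewrite hornerD horner_sum hornerM hornerC hornerXn circulant_poly_unit // [(_ + _)%:C]rmorphD.
  rewrite mulrDr [X in _ = _ + X]mulrC; congr (_ + _).
  rewrite rmorph_sum mulr_sumr; apply: eq_big_seq => a as_ /=.
  rewrite -two_sub_unit ?normcX ?z1 ?expr1n // !hornerE.
  have -> : z ^+ S = z ^+ (S - a) * z ^+ a by rewrite -exprD subnK ?leS.
  have za0 : z ^+ a != 0 by rewrite expf_neq0.
  rewrite exprD -[in X in _ - X * _](subnK (leS as_)) exprD.
  by rewrite !mulrBr -!mulrA divff //; ring.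
have p1 z : normc z = 1 -> p.[z] != 0.
  move=> z1; rewrite pE // mulf_neq0 ?expf_neq0 -?normc_gt0 ?z1 //.
  rewrite circulant_poly_unit // normc_real normr_gt0 gt_eqF // ltr_wpDl //.
  by apply: sumr_ge0 => a _; exact: sqr_ge0.
have [C [rs [C0 rs1 E]]] := poly_normc_factor p1.
exists C, rs; split=> // z z1.
by rewrite -E pE // normcM normcX z1 expr1n mul1r.
Qed.

(** With h_a = 1 + z^d + ... + z^(a - d) one has z^a - 1 = (z^d - 1) h_a, so the
    symbol is - z^(-S) (z^d - 1)^2 g, where g = sum_a z^(S - a) h_a^2. A zero
    of g on the circle would be a zero of the symbol, hence a d-th root of
    unity; but there g equals sum_a (a/d)^2 = q / d^2. *)
Lemma symbol_factor_decoupled u : coupling beta alpha u = 0 ->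
  exists (C : R) (rs : seq R[i]), [/\ 0 < C, all (fun w => normc w != 1) rs,
    forall z, normc z = 1 ->
      normc (circulant_poly beta s alpha u z) =
      normc (1 - z ^+ d) ^+ 2 * (C * \prod_(w <- rs) normc (z - w)) &
    C * \prod_(w <- rs) normc (1 - w) = q%:R / d%:R ^+ 2].
Proof.
move=> W0; have d0 := gcd_jumps_gt0.
have dR : d%:R != 0 :> R[i] by rewrite pnatr_eq0 -lt0n.
pose h a (z : R[i]) := \sum_(i < (a %/ d)%N) z ^+ (d * i).
pose g : {poly R[i]} := \sum_(a <- s) 'X^(S - a) * (\sum_(i < (a %/ d)%N) 'X^(d * i)) ^+ 2.
have gE z : g.[z] = \sum_(a <- s) z ^+ (S - a) * h a z ^+ 2.
  rewrite horner_sum; apply: eq_bigr => a _.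
  rewrite hornerM hornerXn horner_exp horner_sum; congr (_ * _ ^+ 2).
  by apply: eq_bigr => i _; rewrite hornerXn.
have dvd a : a \in s -> (d %| a)%N by move=> as_; rewrite d_def; exact: biggcd_dvd.
have hE a z : a \in s -> z ^+ a - 1 = (z ^+ d - 1) * h a z.
  move=> /dvd da; rewrite -{1}(divnK da) mulnC exprM subrX1; congr (_ * _).
  by apply: eq_bigr => i _; rewrite exprM.
have Pg z : normc z = 1 -> normc (circulant_poly beta s alpha u z) =
      normc (1 - z ^+ d) ^+ 2 * normc g.[z].
  move=> z1; have z0 : z != 0 by rewrite -normc_gt0 z1.
  suff : z ^+ S * circulant_poly beta s alpha u z = - (1 - z ^+ d) ^+ 2 * g.[z].
    move=> /(congr1 (@normc R)); rewrite !normcM normcX z1 expr1n mul1r => ->.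
    by rewrite normcN normcM expr2.
  rewrite gE mulr_sumr circulant_poly_unit // W0 addr0 rmorph_sum mulr_sumr.
  apply: eq_big_seq => a as_ /=.
  rewrite -two_sub_unit ?normcX ?z1 ?expr1n //.
  have -> : z ^+ S = z ^+ (S - a) * z ^+ a by rewrite -exprD subnK ?leS.
  have za0 : z ^+ a != 0 by rewrite expf_neq0.
  transitivity (z ^+ (S - a) * (- (z ^+ a - 1) ^+ 2)); last by rewrite hE //; ring.
  rewrite -mulrA; congr (_ * _); rewrite !mulrBr divff //; ring.
have g1 z : z ^+ d = 1 -> g.[z] = q%:R / d%:R ^+ 2.
  move=> zd; rewrite gE q_def natr_sum mulr_suml; apply: eq_big_seq => a as_.
  have -> : h a z = (a %/ d)%:R.
    rewrite /h; under eq_bigr do rewrite exprM zd expr1n.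
    by rewrite sumr_const card_ord.
  have -> : z ^+ (S - a) = 1.
    have /dvdnP[k ->] : (d %| S - a)%N.
      apply: dvdn_sub; last exact: dvd.
      by rewrite /S big_seq; apply: (big_ind (fun x => d %| x)%N) => //; exact: dvdn_add.
    by rewrite mulnC exprM zd expr1n.
  rewrite mul1r -{2}(divnK (dvd a as_)) natrX natrM exprMn mulfK //.
  by rewrite expf_neq0.
have gn0 z : normc z = 1 -> g.[z] != 0.
  move=> z1; have [zd|zd] := eqVneq (z ^+ d) 1.
    rewrite g1 // mulf_neq0 ?invr_eq0 ?expf_neq0 // pnatr_eq0 -lt0n.
    exact: sum_sqr_jumps_gt0.
  apply/eqP => gz; case/eqP: zd.
  have := Pg z z1; rewrite gz normc0 mulr0 circulant_poly_unit // W0 addr0 normc_real.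
  rewrite ger0_norm; last by apply: sumr_ge0 => a _; exact: sqr_ge0.
  move/eqP; rewrite big_seq psumr_eq0 => [/allP all0|a _]; last exact: sqr_ge0.
  rewrite d_def; apply: expr_biggcd.
    by case: s s0 s_ge1 => // a s' _ /= /andP[a0 _]; exists a; rewrite ?mem_head.
  move=> a as_; have := all0 a as_; rewrite as_ /= sqrf_eq0 normc_eq0 subr_eq0.
  by move/eqP.
have [C [rs [C0 rs1 E]]] := poly_normc_factor gn0.
exists C, rs; split=> //; first by move=> z z1; rewrite Pg // E.
rewrite -E g1 ?expr1n // normcM normcV normcX !normc_nat //.
Qed.

End Factorization.

End Symbol.

(** * Contribution of the zeros on the unit circle *)

Section Count.
Variable R : realType.
Local Open Scope complex_scope.
Import ComplexField.Normc.

(** Raising to the power d permutes the n-th roots of unity. *)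
Lemma prod_twist n d (theta : R) : (0 < n)%N -> coprime n d ->
  \prod_(0 <= t < n) normc (1 - unit_circle ((theta + t%:R) / n%:R) ^+ d : R[i])
  = normc (1 - unit_circle theta ^+ d : R[i]).
Proof.
move=> n0 nd; have nR : n%:R != 0 :> R by rewrite pnatr_eq0 -lt0n.
have wP : n.-primitive_root ((unit_circle n%:R^-1 : R[i]) ^+ d).
  by rewrite (prim_root_exp_coprime _ (prim_unit_circle R n0)) coprime_sym.
have nth : unit_circle (theta / n%:R) ^+ n = unit_circle theta :> R[i].
  by rewrite -unit_circleX mulrCA divff // mulr1.
have := prod_twisted_roots n0 wP 1 (unit_circle (theta / n%:R) ^+ d).
rewrite expr1n [in X in _ = X -> _]exprAC nth => <-.
rewrite normc_prod; apply: eq_bigr => t _; congr (normc (1 - _)).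
by rewrite mulrDl unit_circleD unit_circleX exprMn exprAC.
Qed.

Lemma prod_twist0 n d : (0 < n)%N -> coprime n d ->
  \prod_(1 <= t < n) normc (1 - unit_circle (t%:R / n%:R) ^+ d : R[i]) = n%:R.
Proof.
move=> n0 nd.
have wP : n.-primitive_root ((unit_circle n%:R^-1 : R[i]) ^+ d).
  by rewrite (prim_root_exp_coprime _ (prim_unit_circle R n0)) coprime_sym.
rewrite -[RHS](normc_nat R) -(prod_one_sub_roots n0 wP) normc_prod.
by apply: eq_bigr => t _; rewrite unit_circleX exprAC.
Qed.

Lemma coupling_eq0 beta (alpha : seq nat) delta u : (0 < beta)%N ->
  delta = gcdn (\big[gcdn/0]_(a <- alpha) a)%N beta ->
  (coupling R beta alpha u == 0) = (beta %/ delta %| u)%N.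
Proof.
move=> beta0 deltaE.
have db : (delta %| beta)%N by rewrite deltaE dvdn_gcdr.
have delta0 : (0 < delta)%N by rewrite deltaE gcdn_gt0 beta0 orbT.
have one (a : nat) : (normc (1 - unit_circle ((u * a)%:R / beta%:R) : R[i]) ^+ 2 == 0)
   = (beta %| u * a)%N.
  rewrite sqrf_eq0 normc_eq0 subr_eq0 unit_circleX.
  by rewrite (prim_order_dvd (prim_unit_circle R beta0)) eq_sym.
rewrite -(dvdn_pmul2r delta0) divnK //.
rewrite /coupling psumr_eq0; last by move=> a _; exact: sqr_ge0.
under eq_all do rewrite one.
apply/allP/idP => [h|h a aalpha]; last first.
  apply: dvdn_trans h _; apply: dvdn_mul => //.
  by rewrite deltaE (dvdn_trans (dvdn_gcdl _ _)) // biggcd_dvd.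
rewrite deltaE muln_gcdr dvdn_gcd; apply/andP; split; last exact: dvdn_mull.
rewrite big_seq; apply: (big_ind (fun x => beta %| u * x)%N) => [|x y hx hy|a /h //].
  by rewrite muln0 dvdn0.
by rewrite muln_gcdr dvdn_gcd hx.
Qed.

(** The indices u with vanishing coupling are the multiples m t of
    m = beta / delta, for which e(u/beta) = e(t/delta). *)
Lemma prod_coupling_zero beta (alpha : seq nat) delta d : (0 < beta)%N ->
  delta = gcdn (\big[gcdn/0]_(a <- alpha) a)%N beta -> coprime d delta ->
  \prod_(1 <= u < beta) (if coupling R beta alpha u == 0
     then normc (1 - unit_circle (u%:R / beta%:R) ^+ d : R[i]) ^+ 2 else 1)
  = delta%:R ^+ 2.
Proof.
move=> beta0 deltaE ddelta.
have db : (delta %| beta)%N by rewrite deltaE dvdn_gcdr.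
have delta0 : (0 < delta)%N by rewrite deltaE gcdn_gt0 beta0 orbT.
set m := (beta %/ delta)%N.
have bE : beta = (m * delta)%N by rewrite divnK.
have m0 : (0 < m)%N by rewrite divn_gt0 // dvdn_leq.
pose F u := if u == 0%N then 1 else if (m %| u)%N
     then normc (1 - unit_circle (u%:R / beta%:R) ^+ d : R[i]) ^+ 2 else 1 : R.
transitivity (\prod_(0 <= u < m * delta) F u).
  rewrite -bE [RHS]big_ltn // {1}/F eqxx mul1r; apply: eq_big_nat => u /andP[u0 _].
  by rewrite /F gtn_eqF // (coupling_eq0 _ beta0 deltaE).
rewrite prod_blocks.
transitivity (\prod_(0 <= t < delta) F (m * t)%N).
  apply: eq_bigr => t _; rewrite big_ltn // add0n big_nat_cond big1 ?mulr1 //.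
  move=> v /andP[/andP[v0 vm] _]; rewrite /F addn_eq0 gtn_eqF //=.
  by rewrite dvdn_addl ?dvdn_mulr // gtnNdvd.
rewrite big_ltn // muln0 {1}/F eqxx mul1r.
rewrite -[in RHS](prod_twist0 delta0 (_ : coprime delta d)) 1?coprime_sym //.
rewrite -prodrXl; apply: eq_big_nat => t /andP[t0 _].
rewrite /F muln_eq0 !gtn_eqF //= dvdn_mulr // bE !natrM invfM mulrACA divff ?mul1r //.
by rewrite pnatr_eq0 -lt0n.
Qed.

Section Symbols.
Variables (beta : nat) (s alpha : seq nat) (d q : nat).
Hypotheses (s0 : s != [::]) (s_ge1 : all (fun a => 1 <= a)%N s).
Hypothesis d_def : d = (\big[gcdn/0]_(a <- s) a)%N.
Hypothesis q_def : q = (\sum_(a <- s) a ^ 2)%N.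

(** The pair consists of the modulus of the leading coefficient and of the
    zeros off the unit circle. The zeros on the circle, twice the d-th roots of unity,
    leave the Mahler measure unchanged. *)
Lemma symbol_factor u : exists cr : R * seq R[i],
  [/\ 0 < cr.1, all (fun w => normc w != 1) cr.2,
    forall z, normc z = 1 -> normc (circulant_poly beta s alpha u z) =
      (if coupling R beta alpha u == 0 then normc (1 - z ^+ d) ^+ 2 else 1)
      * (cr.1 * \prod_(w <- cr.2) normc (z - w)),
    coupling R beta alpha u = 0 ->
      cr.1 * \prod_(w <- cr.2) normc (1 - w) = q%:R / d%:R ^+ 2 &
    mahler_measure (@circulant_poly R beta s alpha u) =
      cr.1 * \prod_(w <- cr.2) Num.max 1 (normc w)].
Proof.
have d0 := gcd_jumps_gt0 s0 s_ge1 d_def.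
have [W0|W0] := eqVneq (coupling R beta alpha u) 0; last first.
  have Wp : 0 < coupling R beta alpha u by rewrite lt_def W0 coupling_ge0.
  have [C [rs [C0 rs1 E]]] := symbol_factor_coupled s Wp.
  exists (C, rs); split=> //=.
  - by move=> z z1; rewrite mul1r E.
  - by move=> W0'; rewrite W0' eqxx in W0.
  - by apply: mahler_measure_roots => // t; rewrite E ?normc_unit_circle.
have [C [rs [C0 rs1 E E1]]] := symbol_factor_decoupled s0 s_ge1 d_def q_def W0.
exists (C, rs); split=> //=.
have dP := prim_unit_circle R d0.
pose U := [seq unit_circle (d%:R^-1 : R) ^+ i | i <- iota 0 d].
have UE z : normc (1 - z ^+ d) = \prod_(w <- U) normc (z - w).
  rewrite normcB -(expr1n _ d) -(prod_twisted_roots d0 dP) normc_prod.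
  rewrite big_map /index_iota subn0; apply: eq_bigr => i _; by rewrite mul1r.
rewrite (@mahler_measure_roots _ _ C (rs ++ U ++ U)) //; last first.
  move=> t; rewrite E ?normc_unit_circle // UE !big_cat /= expr2; ring.
rewrite !big_cat /=; congr (_ * _).
have -> : \prod_(w <- U) Num.max 1 (normc w) = 1 :> R.
  rewrite big_map big1 // => i _.
  by rewrite normcX normc_unit_circle expr1n maxxx.
by rewrite !mulr1.
Qed.

End Symbols.
End Count.

(** * Counting the spanning trees *)

Local Open Scope classical_set_scope.
Local Open Scope ring_scope.

Section TreeCount.
Variable R : realType.
Local Open Scope complex_scope.
Import ComplexField.Normc.
Variables (beta : nat) (s alpha : seq nat) (d delta q : nat).
Hypotheses (s0 : s != [::]) (s_ge1 : all (fun a => 1 <= a)%N s).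
Hypothesis beta0 : (0 < beta)%N.
Hypothesis alpha_bnd : all (fun a => (1 <= a <= beta %/ 2)%N) alpha.
Hypothesis d_def : d = (\big[gcdn/0]_(a <- s) a)%N.
Hypothesis delta_def : delta = gcdn (\big[gcdn/0]_(a <- alpha) a)%N beta.
Hypothesis d_delta : coprime d delta.
Hypothesis q_def : q = (\sum_(a <- s) a ^ 2)%N.

Definition circulant_jumps n := s ++ [seq (a * n)%N | a <- alpha].

(** With j = u + beta t, the jump alpha n contributes to the j-th eigenvalue a
    term depending on u only, which is the constant term of P_u. *)
Lemma circulant_trees_symbol n : (0 < n)%N -> all (fun a => a < beta * n)%N s ->
  (beta * n)%:R * (nb_spanning_trees (circulant (beta * n) (circulant_jumps n)))%:R =
  \prod_(0 <= u < beta) \prod_(0 <= t < n | (u + beta * t != 0)%N)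
    normc (circulant_poly beta s alpha u
      (unit_circle ((u%:R / beta%:R + t%:R) / n%:R) : R[i])).
Proof.
move=> n0 s_bnd; set N := (beta * n)%N.
have N0 : (0 < N)%N by rewrite muln_gt0 beta0.
have bR : beta%:R != 0 :> R by rewrite pnatr_eq0 -lt0n.
have nR : n%:R != 0 :> R by rewrite pnatr_eq0 -lt0n.
have zP := prim_unit_circle R N0; set zeta := unit_circle _ in zP.
have c_bnd : all (fun a => 0 < a < N)%N (circulant_jumps n).
  rewrite all_cat; apply/andP; split; apply/allP => a.
    by move=> as_; rewrite (allP s_ge1 a as_) (allP s_bnd a as_).
  case/mapP => b /(allP alpha_bnd)/andP[b1 b2] ->; rewrite muln_gt0 b1 n0 /=.
  by rewrite ltn_pmul2r // (leq_ltn_trans b2) // ltn_Pdiv.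
pose term j : R := normc (\sum_(a <- circulant_jumps n)
   (2 - zeta ^+ (j * a) - zeta ^- (j * a))).
have count : N%:R * (nb_spanning_trees (circulant N (circulant_jumps n)))%:R
    = \prod_(0 <= j < N) (if j == 0%N then 1 else term j).
  case: N {N0 s_bnd} zeta zP c_bnd @term => // N zeta zP c_bnd term.
  have := circulant_trees zP c_bnd => /(congr1 (@normc R)).
  rewrite normcM !normc_nat => ->.
  rewrite normc_prod big_mkord big_mkcond /=; apply: eq_bigr => j _.
  by case: j => -[].
rewrite count prod_blocks exchange_big /=; apply: eq_bigr => u _.
rewrite [RHS]big_mkcond /=; apply: eq_bigr => t _.
case: eqP => //= _; rewrite /term; congr normc.
have zE : zeta ^+ (u + beta * t) = unit_circle ((u%:R / beta%:R + t%:R) / n%:R).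
  rewrite /zeta -unit_circleX natrD !natrM; congr unit_circle.
  by field; rewrite nR bR.
rewrite circulant_poly_unit ?normc_unit_circle // -zE rmorphD big_cat /= big_map.
rewrite !(rmorph_sum (@real_complex R)) /=.
have z1 m : normc (zeta ^+ m) = 1 by rewrite normcX normc_unit_circle expr1n.
congr (_ + _); apply: eq_bigr => a _; rewrite two_sub_unit //.
  by rewrite exprM.
suff -> : zeta ^+ ((u + beta * t) * (a * n)) = unit_circle ((u * a)%:R / beta%:R) by [].
rewrite /zeta -unit_circleX.
have -> : ((u + beta * t) * (a * n))%:R * N%:R^-1 = (u * a)%:R / beta%:R + (t * a)%:R :> R.
  by rewrite !natrM natrD natrM; field; rewrite nR bR.
by rewrite unit_circleD unit_circle_nat mulr1.
Qed.

Section Factored.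
Variable cr : nat -> R * seq R[i].
(* The zeros of the symbols off the unit circle, as provided by symbol_factor. *)
Hypothesis crP : forall u z, normc z = 1 ->
  normc (circulant_poly beta s alpha u z) =
    (if coupling R beta alpha u == 0 then normc (1 - z ^+ d) ^+ 2 else 1)
    * ((cr u).1 * \prod_(w <- (cr u).2) normc (z - w)).
Hypothesis cr1 : forall u, coupling R beta alpha u = 0 ->
  (cr u).1 * \prod_(w <- (cr u).2) normc (1 - w) = q%:R / d%:R ^+ 2.

Definition reduced_symbol u (z : R[i]) : R := (cr u).1 * \prod_(w <- (cr u).2) normc (z - w).

Definition reduced_product u n : R :=
  \prod_(0 <= t < n) reduced_symbol u (unit_circle ((u%:R / beta%:R + t%:R) / n%:R)).

(** The product of the |1 - z^d|^2 is delta^2 for the indices u > 0 and n^2 for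
    u = 0; there the factor |g(1)| = q / d^2 of the excluded point z = 1 is
    divided out as well. *)
Lemma nb_spanning_trees_factored n : (0 < n)%N -> coprime n d ->
  all (fun a => a < beta * n)%N s ->
  (nb_spanning_trees (circulant (beta * n) (circulant_jumps n)))%:R =
  (n * delta ^ 2 * d ^ 2)%:R / (beta * q)%:R * \prod_(0 <= u < beta) reduced_product u n.
Proof.
move=> n0 nd s_bnd.
have q0 : q%:R != 0 :> R by rewrite pnatr_eq0 -lt0n (sum_sqr_jumps_gt0 s0 s_ge1 q_def).
have d0 : d%:R != 0 :> R by rewrite pnatr_eq0 -lt0n (gcd_jumps_gt0 s0 s_ge1 d_def).
have b0 : beta%:R != 0 :> R by rewrite pnatr_eq0 -lt0n.
have nR : n%:R != 0 :> R by rewrite pnatr_eq0 -lt0n.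
have W0 : coupling R beta alpha 0 = 0.
  by apply/eqP; rewrite (coupling_eq0 _ _ beta0 delta_def) dvdn0.
have N0 : (beta * n)%:R != 0 :> R by rewrite natrM mulf_neq0.
apply: (mulfI N0); rewrite circulant_trees_symbol // big_ltn //.
have -> : \prod_(1 <= u < beta) \prod_(0 <= t < n | (u + beta * t != 0)%N)
    normc (circulant_poly beta s alpha u
      (unit_circle ((u%:R / beta%:R + t%:R) / n%:R) : R[i]))
  = delta%:R ^+ 2 * \prod_(1 <= u < beta) reduced_product u n.
  rewrite -(prod_coupling_zero R beta0 delta_def d_delta) -big_split /=.
  apply: eq_big_nat => u /andP[u0 _].
  rewrite (eq_bigl xpredT) => [|t]; last by rewrite addn_eq0 negb_and gtn_eqF.
  under eq_bigr do rewrite crP ?normc_unit_circle //.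
  rewrite big_split /=; congr (_ * _); case: eqP => _; last by rewrite big1.
  by rewrite prodrXl prod_twist.
have -> : \prod_(0 <= t < n | (0 + beta * t != 0)%N)
    normc (circulant_poly beta s alpha 0
      (unit_circle ((0%:R / beta%:R + t%:R) / n%:R) : R[i]))
  = n%:R ^+ 2 * (d%:R ^+ 2 / q%:R) * reduced_product 0 n.
  rewrite big_ltn_cond // muln0 eqxx /=.
  have -> : reduced_product 0 n = q%:R / d%:R ^+ 2 *
      \prod_(1 <= t < n) reduced_symbol 0 (unit_circle (t%:R / n%:R)).
    rewrite /reduced_product big_ltn //; congr (_ * _).
      by rewrite mul0r addr0 mul0r unit_circle0 /reduced_symbol cr1.
    by apply: eq_bigr => t _; rewrite mul0r add0r.
  rewrite mulrA -[n%:R ^+ 2 * _ * _]mulrA [_ / _ * (_ / _)](_ : _ = 1) ?mulr1; last first.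
    by field; rewrite q0 d0.
  rewrite -[X in _ = X ^+ 2 * _](prod_twist0 R n0 nd) -prodrXl -big_split /=.
  rewrite big_nat_cond [RHS]big_nat_cond.
  apply: eq_big => [t|t /andP[/andP[t0 _] _]].
    by case: t => // t; rewrite muln_eq0 negb_or -lt0n beta0.
  by rewrite mul0r add0r crP ?normc_unit_circle // W0 eqxx.
rewrite [in RHS]big_ltn // !natrM.
by field; rewrite ?nR ?b0 ?q0.
Qed.

End Factored.
End TreeCount.

Theorem theorem3 (R : realType) (k l beta : nat)
    (s : k.-tuple nat) (alpha : l.-tuple nat)
    (k_ge1 : (1 <= k)%N) (beta_ge1 : (1 <= beta)%N)
    (s_ge1 : all (fun a => (1 <= a)%N) s)
    (s_incr : sorted ltn s)
    (alpha_bnd : all (fun a => (1 <= a <= beta %/ 2)%N) alpha)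
    (alpha_incr : sorted ltn alpha)
    (d : nat) (d_def : d = (\big[gcdn/0]_(a <- s) a)%N)
    (delta : nat) (delta_def : delta = gcdn (\big[gcdn/0]_(a <- alpha) a)%N beta)
    (d_delta : coprime d delta)
    (tau : nat -> nat)
    (tau_def : forall n : nat, (0 < n)%N -> (last 0%N s <= (beta * n) %/ 2)%N ->
       tau n = nb_spanning_trees
         (circulant (beta * n) (s ++ [seq (a * n)%N | a <- alpha])))
    (q : nat) (q_def : q = (\sum_(a <- s) a ^ 2)%N)
    (A : R)
    (A_def : A = \prod_(0 <= u < beta)
       mahler_measure (@circulant_poly R beta s alpha u)) :
  (fun n : nat => (tau n)%:R /
     ((n * delta ^ 2 * d ^ 2)%:R / (beta * q)%:R * A ^+ n) : R)
    @ within [set n : nat | coprime n d] \oo --> (1 : R).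
Proof.
have s0 : s != [::] :> seq nat by rewrite -size_eq0 size_tuple -lt0n.
have [cr crP] := choice (symbol_factor R beta alpha s0 s_ge1 d_def q_def).
pose M u := (cr u).1 * \prod_(w <- (cr u).2) Num.max 1 (ComplexField.Normc.normc w).
have M0 u : 0 < M u.
  rewrite mulr_gt0 //; first by have [] := crP u.
  by apply: prodr_gt0 => w _; rewrite lt_max ltr01.
have lim : (fun n => \prod_(0 <= u < beta) (reduced_product beta cr u n / M u ^+ n))
    @ \oo --> (1 : R).
  elim: (index_iota 0 beta) => [|u r ih].
    by apply: (@cvg_near_eq R _ _ (cst 1)); [apply: nearW => n; rewrite big_nil | exact: cvg_cst].
  have [c0 rs1 _ _ _] := crP u.
  have h := cvgM (root_product_growth (u%:R / beta%:R) c0 rs1) ih; rewrite mulr1 in h.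
  by apply: cvg_near_eq (h _); apply: nearW => n; rewrite big_cons.
apply: cvg_near_eq (cvg_within_filter _ lim).
rewrite near_withinE; near=> n => /= nd.
have n0 : (0 < n)%N by near: n; exact: nbhs_infty_gt.
have s_lt a : a \in s -> (2 * a <= beta * n)%N.
  move=> as_; apply: (@leq_trans n); last by rewrite leq_pmull.
  apply: leq_trans (_ : (2 * \sum_(a <- s) a <= n)%N).
    by rewrite leq_mul2l /= (big_rem a) //= leq_addr.
  by near: n; exact: nbhs_infty_ge.
rewrite tau_def //; last first.
  have lasts : last 0%N s \in (s : seq nat).
    by case: (s : seq nat) s0 => // a s' _; exact: mem_last.
  by rewrite leq_divRL // mulnC s_lt.
have s_bnd : all (fun a => a < beta * n)%N s.
  apply/allP => a as_; apply: leq_trans (s_lt a as_).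
  by rewrite ltn_Pmull // (allP s_ge1).
have q0 : q%:R != 0 :> R by rewrite pnatr_eq0 -lt0n (sum_sqr_jumps_gt0 s0 s_ge1 q_def).
have d0 : d%:R != 0 :> R by rewrite pnatr_eq0 -lt0n (gcd_jumps_gt0 s0 s_ge1 d_def).
have b0 : beta%:R != 0 :> R by rewrite pnatr_eq0 -lt0n.
have nR : n%:R != 0 :> R by rewrite pnatr_eq0 -lt0n.
have delta0 : delta%:R != 0 :> R.
  by rewrite pnatr_eq0 delta_def -lt0n gcdn_gt0 beta_ge1 orbT.
have K0 : (n * delta ^ 2 * d ^ 2)%:R / (beta * q)%:R != 0 :> R.
  by rewrite mulf_neq0 ?invr_eq0 // !natrM ?mulf_neq0 // expf_neq0.
rewrite (nb_spanning_trees_factored s0 s_ge1 beta_ge1 alpha_bnd d_def delta_def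
  d_delta q_def (cr := cr)) //.
- rewrite invfM mulrACA divff // mul1r A_def -prodrXl -prodfV -big_split /=.
  apply: eq_bigr => u _; congr (_ / _ ^+ n).
  by have [_ _ _ _ ->] := crP u.
- by move=> u z z1; have [_ _ h _ _] := crP u; exact: h.
- by move=> u W0; have [_ _ _ h _] := crP u; exact: h.
Unshelve. all: by end_near.
Qed.
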